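(* Let $(\mathcal A,\mathcal H,D)$ be a spectral triple. If $s$ is an exponent of singular traceability for $|D|^{-1}$, namely there is a singular trace $\tau_\omega$ which is non-trivial on the ideal generated by $|D|^{-s}$, then the functional $a\mapsto\tau_\omega(a|D|^{-s})$ is a trace state (called a Hausdorff-Besicovitch functional) on the algebra $\mathcal A$.
   Context: A spectral triple $(\mathcal A,\mathcal H,D)$ consists of a $*$-algebra $\mathcal A$ acting on a Hilbert space $\mathcal H$ and a self-adjoint operator $D$ on $\mathcal H$ with compact resolvent such that $[D,a]$ is bounded for every $a\in\mathcal A$. It is assumed that $0$ is not an eigenvalue of $D$ (in general one replaces $D$ with its restriction to $\ker(D)^\perp$), so that $|D|^{-1}$ is a compact operator. A singular trace on $\mathcal B(\mathcal H)$ is a positive trace functional (tracial weight, finite on an ideal of compact operators, its domain) which vanishes on the finite rank projections. A compact operator $a$ is singularly traceable if there exists a singular trace which is finite and non-zero on $|a|$; the domain of such a singular trace necessarily contains the ideal generated by $a$. A number $s>0$ is an exponent of singular traceability for a compact operator $a$ if $|a|^s$ is singularly traceable.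
   Formalization: The functional is divided by τ_ω(|D|^{-s}), since otherwise it need not be normalized; ''state'' means positive, norm at most 1, and value 1 at an element acting as the identity, since for a non-unital algebra norm exactly 1 can fail. *)

(* Defs.v *)
From HB Require Import structures.
From mathcomp Require Import all_boot all_order all_algebra.
From mathcomp Require Import sesquilinear complex.
From mathcomp Require Import all_classical all_reals all_analysis.

Set Implicit Arguments.
Unset Strict Implicit.
Unset Printing Implicit Defensive.

Import Order.TTheory GRing.Theory Num.Theory Num.Def.
Import numFieldNormedType.Exports.

Local Open Scope classical_set_scope.
Local Open Scope ring_scope.
Local Open Scope complex_scope.

(* A complex Hilbert space is a complete normed module over R[i] whose norm
   comes from an inner product.  With mathcomp's [{dot _ for conjC}] the form
   is linear in its first argument and conjugate-linear in the second.
   Operators are plain functions H -> H, added and scaled pointwise, and "B(H)"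
   is the predicate [bounded_op].  The order of R[i] is the one in which
   0 <= z means that z is real and nonnegative.  Definitions by [xget] take a
   default value when no object has the required property. *)

Section Operators.
Context {R : realType} {H : completeNormedModType R[i]}.
Variable dot : {dot H for (@conjC R[i])}.

Definition hilbert := forall x : H, dot x x = `|x| ^+ 2.

Definition bounded_op (T : H -> H) := linear T /\ continuous T.

Definition op_bound (T : H -> H) (M : R) :=
  forall x, `|T x| <= M%:C * `|x|.

Definition is_adjoint (T S : H -> H) := forall x y, dot (T x) y = dot x (S y).

Definition adjoint (T : H -> H) : H -> H :=
  xget (fun=> 0) [set S | bounded_op S /\ is_adjoint T S].

Definition positive_op (T : H -> H) :=
  bounded_op T /\ forall x, 0 <= dot (T x) x.

Definition compact_op (T : H -> H) :=
  bounded_op T /\ compact (closure (T @` [set x | `|x| <= 1])).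

Definition finite_rank (T : H -> H) :=
  exists (n : nat) (e : 'I_n -> H),
    forall x, exists c : 'I_n -> R[i], T x = \sum_(i < n) c i *: e i.

Definition projection (P : H -> H) :=
  [/\ bounded_op P, forall x, P (P x) = P x & is_adjoint P P].

(* A possibly unbounded operator is a domain together with a function, of
   which only the values on the domain matter. *)
Definition linear_on (dom : set H) (D : H -> H) :=
  dom 0 /\ forall (c : R[i]) x y, dom x -> dom y ->
    dom (c *: x + y) /\ D (c *: x + y) = c *: D x + D y.

(* D = D^*: the right-to-left implication is symmetry, the left-to-right one is
   the inclusion of the domain of D^* in the domain of D. *)
Definition self_adjoint (dom : set H) (D : H -> H) :=
  [/\ linear_on dom D, dense dom &
      forall y z, (forall x, dom x -> dot (D x) y = dot x z) <->
                  (dom y /\ D y = z)].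

Definition compact_resolvent (dom : set H) (D : H -> H) :=
  exists (l : R[i]) (K : H -> H),
    [/\ compact_op K,
        forall x, dom (K x) /\ D (K x) - l *: K x = x &
        forall x, dom x -> K (D x - l *: x) = x].

Definition zero_not_eigenvalue (dom : set H) (D : H -> H) :=
  forall x, dom x -> D x = 0 -> x = 0.

(* Functional calculus f(D) for a self-adjoint operator with a complete system
   of eigenvectors and f bounded on its spectrum: the bounded operator equal to
   the scalar f(l) on the l-eigenspace.  It is used only for operators with
   compact resolvent and for positive compact operators. *)
Definition fun_calc (dom : set H) (D : H -> H) (f : R -> R) : H -> H :=
  xget (fun=> 0) [set T | bounded_op T /\
    forall (l : R) x, dom x -> D x = l%:C *: x -> T x = (f l)%:C *: x].

(* |T|^s = (T^* T)^(s/2) for T compact and s > 0 *)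
Definition abs_pow (T : H -> H) (s : R) : H -> H :=
  fun_calc setT (adjoint T \o T) (fun l => l `^ (s / 2)).

Definition abs_op (T : H -> H) : H -> H := abs_pow T 1.

(* |D|^(-s) for D self-adjoint and injective with compact resolvent *)
Definition abs_inv_pow (dom : set H) (D : H -> H) (s : R) : H -> H :=
  fun_calc dom D (fun l => `|l| `^ (- s)).

(* A weight is only evaluated on positive operators; 0 * +oo = 0. *)
Definition tracial_weight (tau : (H -> H) -> \bar R) :=
  [/\ forall T, positive_op T -> (0 <= tau T)%E,
      forall S T, positive_op S -> positive_op T ->
        tau (S + T) = (tau S + tau T)%E,
      forall (c : R) T, 0 <= c -> positive_op T ->
        tau (c%:C *: T) = (c%:E * tau T)%E &
      forall S T, bounded_op S -> bounded_op T -> is_adjoint T S ->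
        tau (S \o T) = tau (T \o S)].

Definition finite_positive (tau : (H -> H) -> \bar R) (T : H -> H) :=
  positive_op T /\ (tau T < +oo)%E.

(* z is the value at T of the linear extension of tau to the span of the
   positive operators of finite weight *)
Definition weight_value (tau : (H -> H) -> \bar R) (T : H -> H) (z : R[i]) :=
  exists T1 T2 T3 T4 : H -> H,
    [/\ [/\ finite_positive tau T1, finite_positive tau T2,
            finite_positive tau T3 & finite_positive tau T4],
        T = T1 - T2 + 'i *: (T3 - T4) &
        z = (fine (tau T1) - fine (tau T2))%:C
            + 'i * (fine (tau T3) - fine (tau T4))%:C].

Definition weight_domain (tau : (H -> H) -> \bar R) : set (H -> H) :=
  [set T | exists z, weight_value tau T z].

Definition trace_of (tau : (H -> H) -> \bar R) (T : H -> H) : R[i] :=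
  xget 0 [set z | weight_value tau T z].

(* The domain of a tracial weight is automatically a two-sided ideal. *)
Definition singular_trace (tau : (H -> H) -> \bar R) :=
  [/\ tracial_weight tau,
      weight_domain tau `<=` [set T | compact_op T] &
      forall P, projection P -> finite_rank P -> tau P = 0%E].

Definition nontrivial_on (tau : (H -> H) -> \bar R) (T : H -> H) :=
  (0 < tau (abs_op T) < +oo)%E.

Definition singularly_traceable (T : H -> H) :=
  compact_op T /\ exists tau, singular_trace tau /\ nontrivial_on tau T.

Definition singular_exponent (s : R) (T : H -> H) :=
  0 < s /\ singularly_traceable (abs_pow T s).

End Operators.

(* Associative *-algebras over R[i], not assumed to have a unit. *)
Record star_algebra {R : realType} (A : lmodType R[i])
    (mul : A -> A -> A) (star : A -> A) : Prop := StarAlgebra {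
  sa_mulA : associative mul;
  sa_linearl : forall b, linear (fun a => mul a b);
  sa_linearr : forall a, linear (mul a);
  sa_star_semilinear : forall (c : R[i]) a b,
    star (c *: a + b) = c^* *: star a + star b;
  sa_starK : involutive star;
  sa_star_mul : forall a b, star (mul a b) = mul (star b) (star a)
}.

Record star_action {R : realType} (A : lmodType R[i])
    (mul : A -> A -> A) (star : A -> A)
    (H : completeNormedModType R[i]) (dot : {dot H for (@conjC R[i])})
    (act : A -> H -> H) : Prop := StarAction {
  act_bounded : forall a, bounded_op (act a);
  act_linear : linear act;
  act_mul : forall a b, act (mul a b) = act a \o act b;
  act_star : forall a, is_adjoint dot (act a) (act (star a))
}.

Record spectral_triple {R : realType} (A : lmodType R[i])
    (mul : A -> A -> A) (star : A -> A)
    (H : completeNormedModType R[i]) (dot : {dot H for (@conjC R[i])})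
    (act : A -> H -> H) (dom : set H) (D : H -> H) : Prop := SpectralTriple {
  st_algebra : star_algebra mul star;
  st_hilbert : hilbert dot;
  st_action : star_action mul star dot act;
  st_self_adjoint : self_adjoint dot dom D;
  st_compact_resolvent : compact_resolvent dom D;
  st_commutator : forall a, (forall x, dom x -> dom (act a x)) /\
    exists M : R, forall x, dom x ->
      `|D (act a x) - act a (D x)| <= M%:C * `|x|
}.

(* A state is positive, of norm at most one for the operator norm, and takes
   the value 1 at an element acting as the identity.  When the algebra has a
   unit acting as the identity this is the usual notion; without one the value
   of the norm is not prescribed. *)
Record trace_state {R : realType} (A : lmodType R[i])
    (mul : A -> A -> A) (star : A -> A) (H : completeNormedModType R[i])
    (act : A -> H -> H) (phi : A -> R[i]) : Prop := TraceState {
  ts_linear : forall (c : R[i]) a b, phi (c *: a + b) = c * phi a + phi b;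
  ts_positive : forall a, 0 <= phi (mul (star a) a);
  ts_trace : forall a b, phi (mul a b) = phi (mul b a);
  ts_contractive : forall a (M : R), op_bound (act a) M -> `|phi a| <= M%:C;
  ts_unit : forall e, act e = id -> phi e = 1
}.

(* Main.v *)
(* Write T = |D|^-s = S^2 with S = |D|^(-s/2), and let N(X) = tau(X^* X) be the
   squared Hilbert-Schmidt seminorm of the trace; N(S) = tau(T) is finite and
   N vanishes on finite rank operators.  Since tau(XY) = tau(YX) for X, Y of
   finite seminorm, a |-> tau(aT) is tracial on A as soon as N([S, b]) = 0 for
   each b in A.

   To see that N([S, b]) = 0, cut the spectrum of |D| into blocks at a geometric
   sequence of ratio close to 1.  As [D, b] is bounded, the entry of b between
   two nonadjacent blocks has norm O(1/r), r being the larger radius, so these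
   entries add up to a compact operator K, and N([S, K]) = 0 because tau is
   singular.  The tridiagonal remainder b - K only joins adjacent blocks, on
   which S is nearly the same scalar, so N([S, b - K]) is a small multiple of
   N(S), and letting the ratio tend to 1 concludes.

   The eigenvectors of D are obtained by minimizing |D y| on the unit sphere of
   the orthogonal complement of those already found. *)
Require Import Defs.
From HB Require Import structures.
From mathcomp Require Import all_boot all_order all_algebra.
From mathcomp Require Import sesquilinear complex.
From mathcomp Require Import all_classical all_reals all_analysis.
From mathcomp Require Import ring lra.

Set Implicit Arguments.
Unset Strict Implicit.
Unset Printing Implicit Defensive.

Import Order.TTheory GRing.Theory Num.Theory Num.Def.
Import numFieldNormedType.Exports.

Local Open Scope classical_set_scope.
Local Open Scope ring_scope.
Local Open Scope complex_scope.

(** The trace property of a weight is available only as tau(T^* T) = tau(T T^* ), so the argument is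
    phrased with the seminorm N and its polarization [ip]: for X, Y of finite seminorm, both Y^* X
    and X Y^* have value [ip tau X Y]. Additivity and positivity of tau then reduce all estimates to
    pointwise inequalities between norms of vectors, and no operator outside the bundled ones needs
    a square root or a polar decomposition.

    The obstacle is that only [D, b] is bounded: [|D|, b] need not be, so perturbation formulas for
    powers of |D| are out of reach. The block estimate therefore uses D itself, through a Sylvester
    equation that ignores the signs of the eigenvalues. Moreover the tridiagonal part must be
    controlled relatively to S, not in operator norm, since N need not be finite on bounded
    operators. A geometric sequence of cuts serves both purposes: the far entries are summable, and
    S varies by a bounded ratio over neighbouring blocks, which yields |[S, T] x| <= C r |S x| with
    r tending to 0. *)

Local Notation Re := complex.Re.
Local Notation Im := complex.Im.

(** * Inner products and real-valued norms *)

Section InnerProduct.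
Context {R : realType} {H : completeNormedModType R[i]}.
Variable dot : {dot H for (@conjC R[i])}.
Hypothesis dotH : hilbert dot.

Implicit Types (x y z u v : H) (c d : R[i]).

Lemma dotDl x y z : dot (x + y) z = dot x z + dot y z.
Proof. exact: linearDl. Qed.

Lemma dotDr z x y : dot z (x + y) = dot z x + dot z y.
Proof. exact: linearDr. Qed.

Lemma dotZl c x z : dot (c *: x) z = c * dot x z.
Proof. by rewrite linearZl_LR. Qed.

Lemma dotZr c z x : dot z (c *: x) = conjc c * dot z x.
Proof. by rewrite linearZr_LR. Qed.

Lemma dotC x y : dot x y = (dot y x)^*.
Proof. by rewrite hermC expr0 mul1r. Qed.

Lemma dotNl x z : dot (- x) z = - dot x z.
Proof. by rewrite -scaleN1r dotZl mulN1r. Qed.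

Lemma dotNr z x : dot z (- x) = - dot z x.
Proof. by rewrite -scaleN1r dotZr rmorphN rmorph1 mulN1r. Qed.

Lemma dot0l z : dot 0 z = 0.
Proof. by rewrite -(scale0r (0 : H)) dotZl mul0r. Qed.

Lemma dot0r z : dot z 0 = 0.
Proof. by rewrite dotC dot0l rmorph0. Qed.

Lemma dotBl x y z : dot (x - y) z = dot x z - dot y z.
Proof. by rewrite dotDl dotNl. Qed.

Lemma dotBr z x y : dot z (x - y) = dot z x - dot z y.
Proof. by rewrite dotDr dotNr. Qed.

Lemma dot_suml (I : Type) (r : seq I) (P : pred I) (F : I -> H) z :
  dot (\sum_(i <- r | P i) F i) z = \sum_(i <- r | P i) dot (F i) z.
Proof. by apply: (big_morph (dot^~ z)) => [x y|]; rewrite ?dot0l // dotDl. Qed.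

Lemma dot_sumr (I : Type) (r : seq I) (P : pred I) (F : I -> H) z :
  dot z (\sum_(i <- r | P i) F i) = \sum_(i <- r | P i) dot z (F i).
Proof. by apply: (big_morph (dot z)) => [x y|]; rewrite ?dot0r // dotDr. Qed.

Lemma dot_inj x y : (forall z, dot x z = dot y z) -> x = y.
Proof.
move=> xy; apply/eqP; rewrite -subr_eq0 -(dnorm_eq0 dot).
by rewrite dotBl xy subrr.
Qed.

(* Norms are handled as real numbers: [`|x|] is [(nrm x)%:C]. *)
Definition nrm x : R := Re `|x|.

Lemma nrmE x : `|x| = (nrm x)%:C.
Proof. by rewrite /nrm RRe_real // ger0_real. Qed.

Lemma nrm_ge0 x : 0 <= nrm x.
Proof. by rewrite -ler0c -nrmE. Qed.

Lemma nrmD x y : nrm (x + y) <= nrm x + nrm y.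
Proof. by rewrite -lecR rmorphD /= -!nrmE ler_normD. Qed.

Lemma nrmN x : nrm (- x) = nrm x.
Proof. by rewrite /nrm normrN. Qed.

Lemma nrmB x y : nrm (x - y) = nrm (y - x).
Proof. by rewrite -nrmN opprB. Qed.

Lemma nrm0 : nrm 0 = 0.
Proof. by rewrite /nrm normr0. Qed.

Lemma nrm_triangle y x z : nrm (x - z) <= nrm (x - y) + nrm (y - z).
Proof. by rewrite (le_trans _ (nrmD _ _)) // addrA subrK. Qed.

Lemma nrm_eq0 x : (nrm x == 0) = (x == 0).
Proof. by rewrite -(normr_eq0 x) nrmE -(inj_eq (@complexI R)). Qed.

Lemma nrm_sum (I : Type) (r : seq I) (P : pred I) (F : I -> H) :
  nrm (\sum_(i <- r | P i) F i) <= \sum_(i <- r | P i) nrm (F i).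
Proof.
elim/big_rec2: _ => [|i a b _ IH]; first by rewrite nrm0.
by rewrite (le_trans (nrmD _ _)) // lerD2l.
Qed.

Definition absc c : R := Re `|c|.

Lemma abscE c : `|c| = (absc c)%:C.
Proof. by rewrite /absc RRe_real // ger0_real. Qed.

Lemma absc_ge0 c : 0 <= absc c.
Proof. by rewrite -ler0c -abscE. Qed.

Lemma abscM c d : absc (c * d) = absc c * absc d.
Proof. by apply: complexI; rewrite rmorphM /= -!abscE normrM. Qed.

Lemma absc_real (t : R) : absc t%:C = `|t|.
Proof. by rewrite /absc normc_def /= expr0n addr0 sqrtr_sqr. Qed.

Lemma absc_eq0 c : (absc c == 0) = (c == 0).
Proof. by rewrite -(normr_eq0 c) abscE -(inj_eq (@complexI R)). Qed.

Lemma absc_conj c : absc c^* = absc c.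
Proof. by rewrite /absc normcJ. Qed.

Lemma sqr_absc c : (absc c ^+ 2)%:C = c * conjc c.
Proof. by rewrite rmorphXn /= -abscE sqr_normc. Qed.

Lemma sqr_abscE c : absc c ^+ 2 = Re c ^+ 2 + Im c ^+ 2.
Proof. by apply: complexI; rewrite rmorphXn /= -abscE add_Re2_Im2. Qed.

Lemma conjcM c d : conjc (c * d) = conjc c * conjc d.
Proof. exact: rmorphM. Qed.

Lemma realcM (s t : R) : (s * t)%:C = s%:C * t%:C.
Proof. exact: rmorphM. Qed.

Lemma Re_conj c : Re c^* = Re c. Proof. by case: c. Qed.

Lemma Re_le_absc c : Re c <= absc c.
Proof. by rewrite (le_trans (ler_norm _)) // -lecR -abscE normc_ge_Re. Qed.

Lemma nrmZ c x : nrm (c *: x) = absc c * nrm x.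
Proof. by apply: complexI; rewrite rmorphM /= -!nrmE -abscE normrZ. Qed.

Lemma nrmZR (t : R) x : nrm (t%:C *: x) = `|t| * nrm x.
Proof. by rewrite nrmZ absc_real. Qed.

Lemma dotxx x : dot x x = (nrm x ^+ 2)%:C.
Proof. by rewrite dotH nrmE rmorphXn. Qed.

Lemma sqr_nrm x : nrm x ^+ 2 = Re (dot x x).
Proof. by rewrite dotxx. Qed.

Lemma ReD c d : Re (c + d) = Re c + Re d. Proof. by case: c; case: d. Qed.

Lemma ReN c : Re (- c) = - Re c. Proof. by case: c. Qed.

Lemma nrm_sqrD x y : nrm (x + y) ^+ 2 = nrm x ^+ 2 + nrm y ^+ 2 + 2 * Re (dot x y).
Proof. by rewrite !sqr_nrm dotDl !dotDr !ReD (dotC y x) Re_conj; ring. Qed.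

Lemma nrm_sqrDZ c x y :
  nrm (x + c *: y) ^+ 2
  = nrm x ^+ 2 + 2 * Re (c * dot y x) + absc c ^+ 2 * nrm y ^+ 2.
Proof.
rewrite nrm_sqrD nrmZ exprMn dotZr (dotC x y) -rmorphM Re_conj; ring.
Qed.

Lemma parallelogram x y :
  nrm (x - y) ^+ 2 = 2 * nrm x ^+ 2 + 2 * nrm y ^+ 2 - nrm (x + y) ^+ 2.
Proof. rewrite !nrm_sqrD nrmN dotNr ReN; ring. Qed.

Lemma pythagoras x y : dot x y = 0 -> nrm (x + y) ^+ 2 = nrm x ^+ 2 + nrm y ^+ 2.
Proof. by move=> xy; rewrite nrm_sqrD xy mulr0 addr0. Qed.

(** Discriminant argument: for c a real multiple t of the conjugate of b, the hypothesis becomes a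
    real quadratic polynomial in t, tested at t = -1/g, or at a t making it -1 when g = 0. It serves
    the inner product, the form [ip], and the Euler-Lagrange equation of the minimizer. *)
Lemma quadratic_bound (a g : R) (b : R[i]) : 0 <= g ->
  (forall c, 0 <= a + 2 * Re (c * b) + absc c ^+ 2 * g) -> absc b ^+ 2 <= a * g.
Proof.
move=> g0 abg; set m := absc b ^+ 2.
have abt (t : R) : 0 <= a + 2 * t * m + t ^+ 2 * m * g.
  have := abg (t%:C * conjc b); rewrite -mulrA (mulrC (conjc b)) -sqr_absc -/m.
  rewrite -rmorphM /= sqr_abscE.
  have -> : (Re (t%:C * conjc b)) ^+ 2 + (Im (t%:C * conjc b)) ^+ 2 = t ^+ 2 * m.
    rewrite /m sqr_abscE; case: (b) => u v /=; ring.
  by rewrite mulrA.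
have m0 : 0 <= m by exact: sqr_ge0.
have [g_gt0|] := ltP 0 g.
  have := abt (- g^-1).
  have -> : a + 2 * - g^-1 * m + (- g^-1) ^+ 2 * m * g = a - m / g by field; lra.
  by rewrite subr_ge0 ler_pdivrMr.
move=> gle; have g_eq0 : g = 0 by lra.
rewrite g_eq0 mulr0 leNgt; apply/negP => m_gt0.
have := abt (- (a + 1) / (2 * m)); rewrite g_eq0 mulr0 addr0.
have -> : a + 2 * (- (a + 1) / (2 * m)) * m = - 1 by field; lra.
lra.
Qed.

Lemma cauchy_schwarz x y : absc (dot x y) <= nrm x * nrm y.
Proof.
rewrite -(@ler_pXn2r _ 2) ?nnegrE ?mulr_ge0 ?nrm_ge0 ?absc_ge0 //.
rewrite exprMn mulrC dotC absc_conj mulrC.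
apply: quadratic_bound => [|c]; first exact: sqr_ge0.
by rewrite -nrm_sqrDZ sqr_ge0.
Qed.

End InnerProduct.

(** * Continuity, completeness and compactness with real radii *)

Section Topology.
Context {R : realType} {H : completeNormedModType R[i]}.

Lemma complex_gt0 (e : R[i]) : 0 < e -> 0 < Re e /\ e = (Re e)%:C.
Proof.
move=> e0; have eE : (Re e)%:C = e by rewrite RRe_real // gtr0_real.
by split; rewrite // -ltcR eE.
Qed.

Lemma nbhs_nrmP (x : H) (P : set H) :
  nbhs x P <-> exists2 d : R, 0 < d & forall y, nrm (x - y) < d -> P y.
Proof.
split=> [/nbhs_ballP[e /complex_gt0[e0 eE] xe]|[d d0 xd]].
  exists (Re e) => // y xy; apply: xe; rewrite -ball_normE /ball_ /= eE nrmE ltcR.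
  exact: xy.
apply/nbhs_ballP; exists d%:C; rewrite /= ?ltcR // => y.
by rewrite -ball_normE /ball_ /= nrmE ltcR => /xd.
Qed.

Lemma linear_map0 (T : H -> H) : linear T -> T 0 = 0.
Proof.
by move=> lT; have := lT (-1) 0 0; rewrite scaler0 addr0 scaleN1r => ->; rewrite addNr.
Qed.

Lemma linear_mapZ (T : H -> H) (c : R[i]) x : linear T -> T (c *: x) = c *: T x.
Proof. by move=> lT; have := lT c x 0; rewrite (linear_map0 lT) !addr0. Qed.

Lemma linear_mapB (T : H -> H) x y : linear T -> T (x - y) = T x - T y.
Proof.
by move=> lT; have := lT (-1) y x; rewrite !scaleN1r (addrC _ x) (addrC _ (T x)).
Qed.

Lemma bounded_opP (T : H -> H) : bounded_op T <->
  linear T /\ exists2 M : R, 0 <= M & forall x, nrm (T x) <= M * nrm x.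
Proof.
split=> [[lT cT]|[lT [M M0 TM]]]; split=> //.
  have T0 := linear_map0 lT.
  have /cT/nbhs_nrmP[d d0 Td] : nbhs (T 0) [set y | nrm (T 0 - y) < 1].
    by apply/nbhs_nrmP; exists 1.
  exists (2 / d) => [|x]; first by rewrite divr_ge0 // ltW.
  have [->|x0] := eqVneq x 0; first by rewrite T0 nrm0 mulr0.
  have nx : 0 < nrm x by rewrite lt_def nrm_eq0 x0 nrm_ge0.
  have t0 : 0 < d / (2 * nrm x) by rewrite divr_gt0 ?mulr_gt0.
  have := Td ((d / (2 * nrm x))%:C *: x).
  rewrite /= T0 !sub0r !nrmN linear_mapZ // !nrmZR gtr0_norm //.
  have -> : d / (2 * nrm x) * nrm x = d / 2 by field; rewrite gt_eqF.
  have -> : d / 2 < d = true by apply/idP; lra.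
  move=> /(_ isT) h.
  have : nrm (T x) < 1 / (d / (2 * nrm x)) by rewrite ltr_pdivlMr // mulrC.
  move=> /ltW /le_trans; apply; rewrite le_eqVlt; apply/orP; left; apply/eqP.
  by field; rewrite !gt_eqF.
move=> x A /nbhs_nrmP[e e0 xA]; apply/nbhs_nrmP.
exists (e / (M + 1)) => [|y xy]; first by rewrite divr_gt0 // ltr_wpDl.
apply: xA; rewrite -linear_mapB // (le_lt_trans (TM _)) //.
have M1 : 0 < M + 1 by rewrite ltr_wpDl.
move: xy; rewrite ltr_pdivlMr // mulrC; apply: le_lt_trans.
by rewrite ler_wpM2r ?nrm_ge0 // lerDl.
Qed.

Definition tends (u : nat -> H) (x : H) :=
  forall e : R, 0 < e -> exists N, forall n, (N <= n)%N -> nrm (u n - x) < e.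

Lemma nrm_complete (u : nat -> H) :
  (forall e : R, 0 < e ->
     exists N, forall m n, (N <= m)%N -> (N <= n)%N -> nrm (u m - u n) < e) ->
  exists x, tends u x.
Proof.
move=> uC.
have /cauchy_cvg : cauchy (u @ \oo).
  apply: cauchy_exP => e /= /complex_gt0[e0 eE].
  have [N uN] := uC _ e0; exists (u N); exists N => // n /= Nn.
  by rewrite -ball_normE /ball_ /= eE nrmE ltcR uN.
move=> /cvg_ex[x ux]; exists x => e e0.
have : nbhs x [set y | nrm (x - y) < e] by apply/nbhs_nrmP; exists e.
by move=> /ux[N _ uN]; exists N => n Nn; rewrite nrmB; exact: uN.
Qed.

(** A cluster point is enough: subsequences are extracted by the callers, with the tolerances they
    need. *)
Lemma compact_op_cluster (K : H -> H) (z : nat -> H) :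
  compact_op K -> (forall n, nrm (z n) <= 1) ->
  exists x, forall (e : R) N, 0 < e ->
    exists2 n, (N <= n)%N & nrm (K (z n) - x) < e.
Proof.
move=> [_ cK] z1.
have [x [_ xF]] : closure (K @` [set x | `|x| <= 1])
    `&` cluster ((fun n => K (z n)) @ \oo) !=set0.
  apply: cK; exists 0 => // n _ /=; apply: subset_closure; exists (z n) => //=.
  by rewrite nrmE -[1]/(1%:C) lecR.
exists x => e N e0.
have [] := xF [set y | exists2 n, (N <= n)%N & y = K (z n)]
              [set y | nrm (x - y) < e].
- by exists N => // n Nn; exists n.
- by apply/nbhs_nrmP; exists e.
- by move=> _ [[n Nn ->]]; exists n => //; rewrite nrmB.
Qed.

Lemma dense_nrm (A : set H) x (e : R) :
  dense A -> 0 < e -> exists2 y, A y & nrm (x - y) < e.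
Proof.
move=> dA e0; have [||y [xy Ay]] := dA [set y | nrm (x - y) < e]° .
- exists x; apply/nbhs_nrmP; exists e => //.
- exact: open_interior.
- by exists y => //; have := interior_subset xy.
Qed.

End Topology.

Section Limits.
Context {R : realType} {H : completeNormedModType R[i]}.
Variable dot : {dot H for (@conjC R[i])}.
Hypothesis dotH : hilbert dot.

Lemma null_sequence : exists d : nat -> R,
  [/\ forall n, 0 < d n, forall n, d n <= 1, {homo d : m n / (m <= n)%N >-> n <= m}
    & forall e, 0 < e -> exists N, forall n, (N <= n)%N -> d n < e].
Proof.
exists (fun n => n.+1%:R^-1); split=> [n|n|m n mn|e e0].
- by rewrite invr_gt0 ltr0n.
- by rewrite invf_le1 ?ltr0n // ler1n.
- by rewrite lef_pV2 ?posrE ?ltr0n // ler_nat.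
- have [N _ Ne] := near_infty_natSinv_lt (PosNum e0).
  by exists N => n Nn; exact: Ne.
Qed.

(** Two sequences and two test vectors are allowed so that one estimate covers uniqueness of limits,
    inner products that are eventually constant, and the closedness of D. *)
Lemma tends_dot (u v : nat -> H) x z a b : tends u x -> tends v z ->
  (exists N, forall n, (N <= n)%N -> dot (u n) a = dot (v n) b) ->
  dot x a = dot z b.
Proof.
move=> ux vz [N uv]; apply/eqP; rewrite -subr_eq0 -absc_eq0.
rewrite eq_le absc_ge0 andbT; apply/ler_addgt0Pr => e e0; rewrite add0r.
have M0 : 0 < nrm a + nrm b + 1 by rewrite ltr_wpDl // addr_ge0 ?nrm_ge0.
have [N1 u1] := ux _ (divr_gt0 e0 M0); have [N2 v2] := vz _ (divr_gt0 e0 M0).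
set n := maxn N (maxn N1 N2).
have /u1 un : (N1 <= n)%N by rewrite /n !leq_max leqnn orbT.
have /v2 vn : (N2 <= n)%N by rewrite /n !leq_max leqnn !orbT.
have -> : dot x a - dot z b = dot (v n - z) b - dot (u n - x) a.
  by rewrite !dotBl uv ?leq_maxl //; ring.
rewrite -lecR -abscE (le_trans (ler_normB _ _)) // !abscE -rmorphD lecR.
have h1 := cauchy_schwarz dotH (v n - z) b.
have h2 := cauchy_schwarz dotH (u n - x) a.
have h3 : nrm (v n - z) * nrm b <= e / (nrm a + nrm b + 1) * nrm b.
  by rewrite ler_wpM2r ?nrm_ge0 // ltW.
have h4 : nrm (u n - x) * nrm a <= e / (nrm a + nrm b + 1) * nrm a.
  by rewrite ler_wpM2r ?nrm_ge0 // ltW.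
have h5 : e / (nrm a + nrm b + 1) * nrm b + e / (nrm a + nrm b + 1) * nrm a <= e.
  rewrite -mulrDr -mulrA ler_piMr ?(ltW e0) // mulrC ler_pdivrMr // mul1r; lra.
lra.
Qed.

Lemma tends_cst (x : H) : tends (fun=> x) x.
Proof. by move=> e e0; exists 0%N => n _; rewrite subrr nrm0. Qed.

Lemma tends_dotl (u : nat -> H) x a (c : R[i]) : tends u x ->
  (exists N, forall n, (N <= n)%N -> dot (u n) a = c) -> dot x a = c.
Proof.
move=> ux [N uc]; rewrite -(uc N) //.
by apply: (tends_dot ux (tends_cst (u N))); exists N => n Nn; rewrite !uc.
Qed.

Lemma tends_unique (u : nat -> H) x y : tends u x -> tends u y -> x = y.
Proof.
move=> ux uy; apply: (dot_inj (dot := dot)) => a.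
by apply: (tends_dot ux uy); exists 0%N.
Qed.

Lemma tends_le (u : nat -> H) x (M : R) N : tends u x ->
  (forall n, (N <= n)%N -> nrm (u n) <= M) -> nrm x <= M.
Proof.
move=> ux uM; apply/ler_addgt0Pr => e /ux[N' ue].
have := ue _ (leq_maxr N N'); have := uM _ (leq_maxl N N').
have := nrmD (u (maxn N N')) (x - u (maxn N N')).
by rewrite addrC subrK (nrmB x); lra.
Qed.

Lemma tendsD (u v : nat -> H) x y : tends u x -> tends v y ->
  tends (fun n => u n + v n) (x + y).
Proof.
move=> ux vy e e0; have e2 : 0 < e / 2 by lra.
have [N uN] := ux _ e2; have [N' vN] := vy _ e2.
exists (maxn N N') => n; rewrite geq_max => /andP[/uN + /vN].
have := nrmD (u n - x) (v n - y).
have -> : u n - x + (v n - y) = u n + v n - (x + y) by rewrite opprD addrACA.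
lra.
Qed.

Lemma tends_bounded (u : nat -> H) x (T : H -> H) : bounded_op T -> tends u x ->
  tends (fun n => T (u n)) (T x).
Proof.
move=> /bounded_opP[lT [M M0 TM]] ux e e0.
have M1 : 0 < M + 1 by lra.
have [N uN] := ux _ (divr_gt0 e0 M1); exists N => n /uN.
rewrite -linear_mapB //.
rewrite ltr_pdivlMr // => h.
have := TM (u n - x); have := nrm_ge0 (u n - x); nra.
Qed.

End Limits.

(** * Eigenvectors of a self-adjoint operator with compact resolvent *)

Section Minimizer.
Context {R : realType} {H : completeNormedModType R[i]}.
Variable dot : {dot H for (@conjC R[i])}.
Hypothesis dotH : hilbert dot.
Variables (dom : set H) (D : H -> H).
Hypothesis sD : self_adjoint dot dom D.
Hypothesis cD : compact_resolvent dom D.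

Lemma dom0 : dom 0. Proof. by have [[]] := sD. Qed.

Lemma domDZ (c : R[i]) x y : dom x -> dom y -> dom (c *: x + y).
Proof. by have [[_ h] _ _] := sD => dx dy; have [] := h c _ _ dx dy. Qed.

Lemma opDZ (c : R[i]) x y : dom x -> dom y -> D (c *: x + y) = c *: D x + D y.
Proof. by have [[_ h] _ _] := sD => dx dy; have [] := h c _ _ dx dy. Qed.

Lemma op0 : D 0 = 0.
Proof.
have := opDZ (-1) dom0 dom0.
by rewrite scaler0 addr0 scaleN1r addNr.
Qed.

Lemma domZ (c : R[i]) x : dom x -> dom (c *: x).
Proof. by move=> dx; have := domDZ c dx dom0; rewrite addr0. Qed.

Lemma opZ (c : R[i]) x : dom x -> D (c *: x) = c *: D x.
Proof. by move=> dx; have := opDZ c dx dom0; rewrite op0 !addr0. Qed.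

Lemma domD x y : dom x -> dom y -> dom (x + y).
Proof. by move=> dx dy; have := domDZ 1 dx dy; rewrite scale1r. Qed.

Lemma opD x y : dom x -> dom y -> D (x + y) = D x + D y.
Proof. by move=> dx dy; have := opDZ 1 dx dy; rewrite !scale1r. Qed.

Lemma domB x y : dom x -> dom y -> dom (x - y).
Proof. by move=> dx dy; have := domDZ (-1) dy dx; rewrite scaleN1r addrC. Qed.

Lemma opB x y : dom x -> dom y -> D (x - y) = D x - D y.
Proof.
by move=> dx dy; have := opDZ (-1) dy dx; rewrite !scaleN1r addrC (addrC _ (D x)).
Qed.

Lemma dom_sum (I : Type) (r : seq I) (F : I -> H) :
  (forall i, dom (F i)) -> dom (\sum_(i <- r) F i).
Proof. by move=> dF; elim/big_rec: _ => [|i x _]; [exact: dom0 | exact: domD]. Qed.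

Lemma op_sum (I : Type) (r : seq I) (F : I -> H) :
  (forall i, dom (F i)) -> D (\sum_(i <- r) F i) = \sum_(i <- r) D (F i).
Proof.
move=> dF; elim: r => [|i r IH]; first by rewrite !big_nil op0.
by rewrite !big_cons opD ?IH //; exact: dom_sum.
Qed.

Lemma op_sym x y : dom x -> dom y -> dot (D x) y = dot x (D y).
Proof. by have [_ _ h] := sD => dx dy; apply: (h y (D y)).2. Qed.

(** D equals its adjoint, and belonging to the graph of an adjoint is a family of inner product
    equations, which pass to the limit. *)
Lemma op_closed (u : nat -> H) x z :
  (forall n, dom (u n)) -> tends u x -> tends (D \o u) z -> dom x /\ D x = z.
Proof.
move=> du ux Duz; have [_ _ h] := sD; apply/h => y dy.
rewrite dotC (dotC dot y); congr (_^*).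
by apply: (tends_dot dotH ux Duz); exists 0%N => n _ /=; rewrite op_sym.
Qed.

(* A minimizing sequence for [|D y|] converges: the resolvent makes a
   subsequence [y_k] converge, and the parallelogram law makes [D y_k] Cauchy. *)
Lemma minimizer (W : set H) :
  (forall c x y, W x -> W y -> W (c *: x + y)) ->
  (forall u x, (forall n, W (u n)) -> tends u x -> W x) ->
  (exists x, [/\ dom x, W x & x != 0]) ->
  exists x, [/\ dom x, W x, nrm x = 1 &
    forall y, dom y -> W y -> nrm (D x) * nrm y <= nrm (D y)].
Proof.
move=> WDZ Wcl [x0 [dx0 Wx0 x00]].
have WZ c x : W x -> W (c *: x).
  move=> Wx; have W0 : W 0 by have := WDZ (-1) _ _ Wx Wx; rewrite scaleN1r addNr.
  by have := WDZ c x 0 Wx W0; rewrite addr0.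
have WD x y : W x -> W y -> W (x + y).
  by move=> Wx Wy; have := WDZ 1 x y Wx Wy; rewrite scale1r.
have normalize y : dom y -> W y -> y != 0 ->
    [/\ dom (((nrm y)^-1)%:C *: y), W (((nrm y)^-1)%:C *: y),
        nrm (((nrm y)^-1)%:C *: y) = 1 &
        nrm (D (((nrm y)^-1)%:C *: y)) = (nrm y)^-1 * nrm (D y)].
  move=> dy Wy y0; have ny : nrm y != 0 by rewrite nrm_eq0.
  have ny' : 0 <= (nrm y)^-1 by rewrite invr_ge0 nrm_ge0.
  by split; rewrite ?opZ ?nrmZR ?ger0_norm ?mulVf //; [exact: domZ|exact: WZ].
pose E := [set r : R | exists y, [/\ dom y, W y, nrm y = 1 & r = nrm (D y) ^+ 2]].
have E0 : E !=set0.
  have [d1 W1 n1 _] := normalize _ dx0 Wx0 x00.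
  by exists (nrm (D (((nrm x0)^-1)%:C *: x0)) ^+ 2), (((nrm x0)^-1)%:C *: x0).
have lE : lbound E 0 by move=> _ [y [_ _ _ ->]]; exact: sqr_ge0.
have iE : has_inf E by split=> //; exists 0.
pose m := inf E.
have m0 : 0 <= m by apply: lb_le_inf.
have mle y : dom y -> W y -> m * nrm y ^+ 2 <= nrm (D y) ^+ 2.
  move=> dy Wy; have [->|y0] := eqVneq y 0.
    by rewrite nrm0 expr0n mulr0 sqr_ge0.
  have [d1 W1 n1 Dn] := normalize _ dy Wy y0.
  have ny : 0 < nrm y by rewrite lt_def nrm_eq0 y0 nrm_ge0.
  have : m <= ((nrm y)^-1 * nrm (D y)) ^+ 2.
    by rewrite -Dn; apply: ge_inf; [exists 0|exists (((nrm y)^-1)%:C *: y)].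
  by rewrite exprMn exprVn mulrC ler_pdivlMr // exprn_gt0.
have [del [dl0 dl1 dlm dls]] := @null_sequence R.
have /choice[y yP] : forall n : nat, exists y,
    [/\ dom y, W y, nrm y = 1 & nrm (D y) ^+ 2 < m + del n].
  move=> n; have [r [y [dy Wy ny ->]] ry] := inf_adherent (dl0 n) iE.
  by exists y.
have [l [K [cK _ KD]]] := cD.
have [lK _] := (bounded_opP K).1 cK.1.
have KZ c x : K (c *: x) = c *: K x by exact: linear_mapZ.
(* Since t <= 1 + t^2 and |D y_n|^2 < m + 1, [B] bounds (D - l) y_n. After division by [B] these
   vectors lie in the unit ball, and [K] sends them back to y_n / B. *)
pose B := m + 2 + absc l.
have B0 : 0 < B by have := absc_ge0 l; rewrite /B; lra.
have zB n : nrm (D (y n) - l *: y n) <= B.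
  have [_ _ ny Dy] := yP n; have := dl1 n.
  have := nrmD (D (y n)) (- (l *: y n)); rewrite nrmN nrmZ ny mulr1 /B.
  have : nrm (D (y n)) <= 1 + nrm (D (y n)) ^+ 2.
    by have := sqr_ge0 (nrm (D (y n)) - 1); have := sqr_ge0 (nrm (D (y n))); lra.
  by have := absc_ge0 l; lra.
have [|x1 x1P] := compact_op_cluster (z := fun n => (B^-1)%:C *: (D (y n) - l *: y n)) cK.
  move=> n; rewrite nrmZR ger0_norm ?invr_ge0 ?(ltW B0) //.
  by rewrite mulrC ler_pdivrMr // mul1r.
pose x := B%:C *: x1.
have /choice[k kP] : forall j : nat, exists k,
    (j <= k)%N /\ nrm (y k - x) < del j.
  move=> j; have [k jk kx] := x1P _ j (divr_gt0 (dl0 j) B0); exists k; split=> //.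
  have [dy _ _ _] := yP k.
  move: kx; rewrite KZ KD // => h.
  have -> : y k - x = B%:C *: ((B^-1)%:C *: y k - x1).
    by rewrite scalerBr scalerA -rmorphM divff ?gt_eqF // scale1r.
  by rewrite nrmZR gtr0_norm // mulrC -ltr_pdivlMr.
pose u j := y (k j).
have uP j : [/\ dom (u j), W (u j), nrm (u j) = 1 & nrm (D (u j)) ^+ 2 < m + del j].
  have [? ? ? h] := yP (k j); split=> //; apply: (lt_le_trans h).
  by rewrite lerD2l; apply: dlm; exact: (kP j).1.
have ux : tends u x.
  move=> e /dls[N Ne]; exists N => n /Ne; apply: lt_trans; exact: (kP n).2.
have [z Duz] : exists z, tends (D \o u) z.
  apply: nrm_complete => e e0.
  (* The parallelogram law for D u_i, D u_j and minimality at u_i + u_j give |D(u_i - u_j)|^2 <= 4 d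
     + m |u_i - u_j|^2, and |u_i - u_j|^2 <= 4 d, whence 4 + 4 m. *)
  have [|N Ne] := dls (e ^+ 2 / (4 + 4 * m)).
    by rewrite divr_gt0 ?exprn_gt0 //; lra.
  exists N => i j Ni Nj /=.
  have [di Wi ni Di] := uP i; have [dj Wj nj Dj] := uP j.
  have := dlm _ _ Ni; have := dlm _ _ Nj; have := Ne _ (leqnn N).
  rewrite ltr_pdivlMr; last by lra.
  have := dl1 N; have := dl0 N; have := dl0 i; have := dl0 j.
  set d := del N; set a := del i in Di *; set b := del j in Dj *.
  move=> b0 a0 d0 d1 dE bd ad.
  rewrite -(@ltr_pXn2r _ 2) ?nnegrE ?nrm_ge0 ?(ltW e0) //.
  have h1 := parallelogram dotH (D (u i)) (D (u j)).
  have h2 := parallelogram dotH (u i) (u j).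
  have h3 := mle _ (domD di dj) (WD _ _ Wi Wj).
  rewrite opD // in h3.
  have h4 : nrm (u i - u j) <= 2 * d.
    have := nrm_triangle x (u i) (u j); rewrite (nrmB x).
    have := (kP i).2; have := (kP j).2; rewrite -/a -/b -/(u i) -/(u j); lra.
  have h5 : nrm (u i - u j) ^+ 2 <= 4 * d.
    have := nrm_ge0 (u i - u j); nra.
  rewrite h1; rewrite ni nj in h2; nra.
have [dx Dx] := op_closed (fun n => let: And4 d _ _ _ := uP n in d) ux Duz.
exists x; split=> //.
- by apply: Wcl ux => n; have [] := uP n.
- apply/eqP; rewrite eq_le; apply/andP; split.
    by apply: (tends_le (N := 0%N) ux) => n _; have [_ _ ->] := uP n.
  apply/ler_addgt0Pr => e /ux[N /(_ _ (leqnn N))].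
  have [_ _ nN _] := uP N.
  by have := nrmD (u N - x) x; rewrite subrK nN; lra.
- have Dxm : nrm (D x) ^+ 2 <= m.
    apply/ler_addgt0Pr => e /dls[N Ne].
    have me : 0 <= m + e by have := dl0 N; have := Ne _ (leqnn N); lra.
    rewrite -(sqr_sqrtr me) ler_sqr ?nnegrE ?nrm_ge0 ?sqrtr_ge0 // Dx.
    apply: (tends_le (N := N) Duz) => n /Ne h.
    rewrite -ler_sqr ?nnegrE ?nrm_ge0 ?sqrtr_ge0 // sqr_sqrtr //=.
    by have [_ _ _] := uP n; lra.
  move=> v dv Wv; rewrite -(@ler_pXn2r _ 2) ?nnegrE ?mulr_ge0 ?nrm_ge0 // exprMn.
  by rewrite (le_trans _ (mle _ dv Wv)) // ler_wpM2r ?sqr_ge0.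
Qed.

End Minimizer.

Section Eigenbasis.
Context {R : realType} {H : completeNormedModType R[i]}.
Variable dot : {dot H for (@conjC R[i])}.
Hypothesis dotH : hilbert dot.

(* Vectors of an orthogonal system have norm one or zero; zeros pad the
   system when H is finite-dimensional. *)
Definition orthosys (e : nat -> H) n :=
  (forall i j, (i < n)%N -> (j < n)%N -> i != j -> dot (e i) (e j) = 0) /\
  (forall i, (i < n)%N -> dot (e i) (e i) *: e i = e i).

(* The partial sums of the operator with eigenvalue [g i] at [e i]. *)
Definition diag (e : nat -> H) (g : nat -> R) n (x : H) : H :=
  \sum_(i < n) ((g i)%:C * dot x (e i)) *: e i.

Notation proj e := (diag e (fun=> 1)).

Lemma dot_diag e g n x j : orthosys e n -> (j < n)%N ->
  dot (diag e g n x) (e j) = (g j)%:C * dot x (e j).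
Proof.
move=> [oe ne] jn; rewrite /diag dot_suml (bigD1 (Ordinal jn)) //= big1 => [|i ij].
  rewrite addr0 dotZl -mulrA; congr (_ * _).
  by rewrite -[in RHS](ne _ jn) dotZr -(dotC dot) mulrC.
by rewrite dotZl oe ?mulr0.
Qed.

Lemma dot_diag_proj e g n x : orthosys e n ->
  dot (diag e g n x) (diag e g n x) =
  (\sum_(i < n) g i ^+ 2 * absc (dot x (e i)) ^+ 2)%:C.
Proof.
move=> oe; rewrite {2}/diag dot_sumr rmorph_sum /=; apply: eq_bigr => i _.
rewrite dotZr dot_diag // conjcM conjc_real realcM (sqr_absc (dot x (e i))).
by rewrite expr2 realcM; ring.
Qed.

Lemma nrm_diag e g n x : orthosys e n ->
  nrm (diag e g n x) ^+ 2 = \sum_(i < n) g i ^+ 2 * absc (dot x (e i)) ^+ 2.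
Proof. by move=> oe; rewrite (sqr_nrm dotH) dot_diag_proj. Qed.

Variables (dom : set H) (D : H -> H).
Hypothesis sD : self_adjoint dot dom D.
Hypothesis cD : compact_resolvent dom D.

Definition eigsys (f : nat -> H * R) n :=
  (forall i, (i < n)%N -> dom (f i).1 /\ D (f i).1 = (f i).2%:C *: (f i).1) /\
  orthosys (fun i => (f i).1) n.

(** When no nonzero vector of the domain is left, the vector is 0 and its fictitious eigenvalue
    exceeds all previous moduli and n, so that the moduli stay monotone, nonzero and unbounded. *)
Definition next_eig (f : nat -> H * R) n (p : H * R) :=
  [/\ dom p.1, D p.1 = p.2%:C *: p.1,
      forall i, (i < n)%N -> dot p.1 (f i).1 = 0,
      nrm p.1 = 1 \/ p.1 = 0 /\ p.2 = n.+1%:R + \sum_(i < n) `|(f i).2|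
    & forall y, dom y -> (forall i, (i < n)%N -> dot y (f i).1 = 0) ->
        `|p.2| * nrm y <= nrm (D y)].

(** A minimizer x of |D y|, with minimum m, satisfies <D h, D x> = m^2 <h, x>, first for h
    orthogonal to the earlier eigenvectors, then for all h in the domain. Self-adjointness yields
    D^2 x = m^2 x, that is (D - m)(D + m) x = 0: either D x + m x is an eigenvector for m, or it is
    0 and x is one for -m. *)
Lemma next_eig_exists f n : eigsys f n -> exists p, next_eig f n p.
Proof.
move=> [fD fo]; pose e i := (f i).1.
pose W := [set y : H | forall i, (i < n)%N -> dot y (e i) = 0].
have [[x0 [dx0 Wx0 x00]]|noV] := pselect (exists x, [/\ dom x, W x & x != 0]); last first.
  exists (0, n.+1%:R + \sum_(i < n) `|(f i).2|); split=> /=.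
  - exact: (dom0 sD).
  - by rewrite (op0 sD) scaler0.
  - by move=> i _; rewrite dot0l.
  - by right.
  - move=> y dy Wy; have [->|y0] := eqVneq y 0; first by rewrite nrm0 mulr0 nrm_ge0.
    by exfalso; apply: noV; exists y.
have WDZ (c : R[i]) x y : W x -> W y -> W (c *: x + y).
  by move=> Wx Wy i ni; rewrite dotDl dotZl Wx // Wy // mulr0 addr0.
have Wcl u x : (forall k, W (u k)) -> tends u x -> W x.
  move=> Wu ux i ni; apply: (tends_dotl dotH ux).
  by exists 0%N => k _; exact: Wu.
have [|x [dx Wx nx mx]] := minimizer dotH sD cD WDZ Wcl; first by exists x0.
pose m := nrm (D x).
have m0 : 0 <= m by exact: nrm_ge0.
have EL h : dom h -> W h -> dot (D h) (D x) = (m ^+ 2)%:C * dot h x.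
  move=> dh Wh; apply/eqP; rewrite -subr_eq0 -absc_eq0 -sqrf_eq0.
  rewrite eq_le sqr_ge0 andbT.
  set b := _ - _.
  have g0 : 0 <= nrm (D h) ^+ 2 - m ^+ 2 * nrm h ^+ 2.
    rewrite subr_ge0 -exprMn ler_sqr ?nnegrE ?mulr_ge0 ?nrm_ge0 //; exact: mx.
  (* Minimality along x + c h is a quadratic inequality with constant term 0, because |D x| = m and
     |x| = 1; [quadratic_bound] then forces b = 0. *)
  rewrite -[leRHS](mul0r (nrm (D h) ^+ 2 - m ^+ 2 * nrm h ^+ 2)).
  apply: quadratic_bound => // c.
  have := mx _ (domDZ sD c dh dx) (WDZ c _ _ Wh Wx).
  rewrite (opDZ sD) // (addrC _ x) (addrC _ (D x)) -/m => h1.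
  have : 0 <= nrm (D x + c *: D h) ^+ 2 - m ^+ 2 * nrm (x + c *: h) ^+ 2.
    by rewrite subr_ge0 -exprMn ler_sqr ?nnegrE ?mulr_ge0 ?nrm_ge0.
  rewrite !(nrm_sqrDZ dotH) nx -/m.
  have -> : Re (c * b) = Re (c * dot (D h) (D x)) - m ^+ 2 * Re (c * dot h x).
    rewrite /b mulrBr ReD ReN; congr (_ - _).
    by rewrite mulrCA; case: (c * dot h x) => u v /=; ring.
  nra.
have DxW i : (i < n)%N -> dot (D x) (e i) = 0.
  move=> ni; have [dei Dei] := fD _ ni.
  by rewrite (op_sym sD) // Dei dotZr Wx // mulr0.
have EL' h : dom h -> dot (D h) (D x) = dot h ((m ^+ 2)%:C *: x).
  move=> dh; rewrite dotZr conjc_real.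
  pose h1 := proj e n h; pose h2 := h - h1.
  have dt i : (i < n)%N -> dom (e i) by move=> ni; have [] := fD _ ni.
  have dh1 : dom h1.
    by apply: (dom_sum sD) => i; apply: (domZ sD); apply: dt.
  have dh2 : dom h2 by exact: (domB sD).
  have Wh2 : W h2 by move=> i ni; rewrite dotBl dot_diag // mul1r subrr.
  have -> : h = h1 + h2 by rewrite addrC subrK.
  rewrite (opD sD) // (dotDl dot (D h1)) (dotDl dot h1) (EL h2) // mulrDr; congr (_ + _).
  rewrite /h1 /diag (op_sum sD) => [|i]; last by apply: (domZ sD); apply: dt.
  rewrite !dot_suml big1 ?big1 ?mulr0 // => i _.
    by rewrite dotZl (dotC dot _ x) Wx // rmorph0 mulr0.
  have [dei Dei] := fD _ (ltn_ord i).
  by rewrite (opZ sD) // Dei !dotZl (dotC dot _ (D x)) DxW // rmorph0 !mulr0.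
have [dDx DDx] : dom (D x) /\ D (D x) = (m ^+ 2)%:C *: x.
  by have [_ _ hD] := sD; apply: (hD _ _).1 => y dy; exact: EL'.
pose y := D x + m%:C *: x.
have dy : dom y by apply: (domD sD) => //; exact: (domZ sD).
have mT h : dom h -> W h -> m * nrm h <= nrm (D h) by exact: mx.
have [y0|y0] := eqVneq y 0.
  exists (x, - m); split=> //=; last by rewrite normrN ger0_norm //; exact: mT.
    by rewrite rmorphN scaleNr; apply/eqP; rewrite -addr_eq0 -/y y0.
  by left.
have ny : 0 < nrm y by rewrite lt_def nrm_eq0 y0 nrm_ge0.
exists (((nrm y)^-1)%:C *: y, m); split=> /=.
- exact: (domZ sD).
- rewrite (opZ sD) // scalerA mulrC -scalerA; congr (_ *: _).
  rewrite /y (opD sD) ?(opZ sD) //; last exact: (domZ sD).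
  by rewrite DDx scalerDr scalerA -rmorphM addrC expr2.
- move=> i ni; rewrite dotZl dotDl dotZl DxW // Wx //.
  by rewrite mulr0 addr0 mulr0.
- by left; rewrite nrmZR ger0_norm ?invr_ge0 ?nrm_ge0 // mulVf // gt_eqF.
- by rewrite ger0_norm //; exact: mT.
Qed.

(** Each vector depends on all its predecessors, so a choice function on finite lists is fixed first
    and then iterated; its value on lists that are not eigensystems is arbitrary. *)
Lemma eigenbasis_exists : exists f : nat -> H * R,
  forall n, eigsys f n /\ next_eig f n (f n).
Proof.
have /choice[g gP] : forall w : seq (H * R), exists p,
    eigsys (nth (0, 0) w) (size w) -> next_eig (nth (0, 0) w) (size w) p.
  move=> w.
  have [/next_eig_exists[p pw]|nw] :=
    pselect (eigsys (nth (0, 0) w) (size w)); [by exists p|by exists 0].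
pose build := fix build n : seq (H * R) :=
  if n is k.+1 then rcons (build k) (g (build k)) else [::].
pose f n := g (build n).
have bE n : build n = mkseq f n.
  by elim: n => //= n IH; rewrite mkseqS -IH.
have nE n i : (i < n)%N -> nth (0, 0) (build n) i = f i.
  by move=> ni; rewrite bE nth_mkseq.
have sE n : size (build n) = n by rewrite bE size_mkseq.
have eE n : eigsys (nth (0, 0) (build n)) n -> eigsys f n.
  move=> [h1 [h2 h3]]; split; last split.
  - by move=> i ni; have := h1 i ni; rewrite nE.
  - by move=> i j ni nj; have := h2 i j ni nj; rewrite !nE.
  - by move=> i ni; have := h3 i ni; rewrite !nE.
have eE' n : eigsys f n -> eigsys (nth (0, 0) (build n)) n.
  move=> [h1 [h2 h3]]; split; last split.
  - by move=> i ni; rewrite nE //; exact: h1.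
  - by move=> i j ni nj; rewrite !nE //; exact: h2.
  - by move=> i ni; rewrite !nE //; exact: h3.
have nx n : eigsys f n -> next_eig f n (f n).
  move=> /eE' fn; have := gP (build n); rewrite sE => /(_ fn) [h1 h2 h3 h4 h5].
  split=> //.
  - by move=> i ni; have := h3 i ni; rewrite nE.
  - case: h4 => [|[h4 h6]]; [by left|right; split=> //].
    by rewrite h6; congr (_ + _); apply: eq_bigr => i _; rewrite nE.
  - by move=> y dy yo; apply: h5 => // i ni; rewrite nE //; exact: yo.
exists f => n; suff fn : eigsys f n by split=> //; exact: nx.
elim: n => [|n IH]; first by split; [|split].
have [h1 h2 h3 h4 h5] := nx _ IH; have [i1 [i2 i3]] := IH.
split; last split.
- by move=> i; rewrite ltnS leq_eqVlt => /predU1P[->|/i1].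
- move=> i j; rewrite !ltnS leq_eqVlt => /predU1P[->|ni].
    rewrite leq_eqVlt => /predU1P[->|nj _]; [by rewrite eqxx|exact: h3].
  rewrite leq_eqVlt => /predU1P[->|nj ij]; last exact: i2.
  by rewrite dotC h3 // rmorph0.
- move=> i; rewrite ltnS leq_eqVlt => /predU1P[->|/i3//].
  case: h4 => [n1|[-> _]]; last by rewrite scaler0.
  by rewrite (dotxx dotH) n1 expr1n scale1r.
Qed.

End Eigenbasis.

(** * Completeness of the eigenbasis *)

Section SpectralDecomposition.
Context {R : realType} {H : completeNormedModType R[i]}.
Variable dot : {dot H for (@conjC R[i])}.
Hypothesis dotH : hilbert dot.
Notation proj e := (diag dot e (fun=> 1)).

Lemma diagDZ e g n (c : R[i]) x y :
  diag dot e g n (c *: x + y) = c *: diag dot e g n x + diag dot e g n y.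
Proof.
rewrite /diag scaler_sumr -big_split; apply: eq_bigr => i _ /=.
by rewrite dotDl dotZl mulrDr scalerDl scalerA mulrCA.
Qed.

Lemma diagB e g n x y :
  diag dot e g n (x - y) = diag dot e g n x - diag dot e g n y.
Proof. by have := diagDZ e g n (-1) y x; rewrite !scaleN1r addrC => ->; rewrite addrC. Qed.

Lemma nrm_proj_le e n x : orthosys dot e n -> nrm (proj e n x) <= nrm x.
Proof.
move=> oe; rewrite -ler_sqr ?nnegrE ?nrm_ge0 //.
have -> : nrm x ^+ 2 = nrm (x - proj e n x) ^+ 2 + nrm (proj e n x) ^+ 2.
  rewrite -(pythagoras dotH) ?subrK // {2}/diag dot_sumr big1 // => i _.
  by rewrite dotZr dotBl dot_diag // mul1r subrr mulr0.
by rewrite lerDr sqr_ge0.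
Qed.

Variables (dom : set H) (D : H -> H).
Hypothesis sD : self_adjoint dot dom D.

(* [l i] is nonzero and unconstrained, apart from growth, when [e i = 0]. *)
Record eigenbasis (e : nat -> H) (l : nat -> R) : Prop := Eigenbasis {
  eb_dom : forall i, dom (e i);
  eb_eigen : forall i, D (e i) = (l i)%:C *: e i;
  eb_ortho : forall n, orthosys dot e n;
  eb_mono : {homo (fun i => `|l i|) : m n / (m <= n)%N >-> m <= n};
  eb_gt0 : 0 < `|l 0%N|;
  eb_unbounded : forall C : R, exists n, C <= `|l n|;
  eb_gap : forall n y, dom y -> (forall i, (i < n)%N -> dot y (e i) = 0) ->
    `|l n| * nrm y <= nrm (D y)
}.

Lemma eigenbasisP : compact_resolvent dom D -> zero_not_eigenvalue dom D ->
  exists e l, eigenbasis e l.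
Proof.
move=> cD D0; have [f fP] := eigenbasis_exists dotH sD cD.
have fo n : eigsys dot dom D f n by have [] := fP n.
have fx n : next_eig dot dom D f n (f n) by have [] := fP n.
pose e i := (f i).1; pose l i := (f i).2.
have de i : dom (e i) by have [] := fx i.
have De i : D (e i) = (l i)%:C *: e i by have [] := fx i.
exists e, l; split=> //.
- by move=> n; have [] := fo n.
- apply/nondecreasing_seqP => n.
  have [_ _ _ _ gap] := fx n.
  have [dn Dn on [n1|[en ln]] _] := fx n.+1; last first.
    rewrite {2}/l ln big_ord_recr /=.
    have h : 0 <= n.+2%:R + \sum_(i < n) `|l i| by rewrite addr_ge0 ?sumr_ge0.
    by rewrite addrA (ger0_norm (addr_ge0 h (normr_ge0 _))) lerDr.
  have := gap _ dn (fun i ni => on i (ltnW ni)).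
  by rewrite Dn nrmZR n1 !mulr1.
- have [_ De0 _ [n1|[_ l0]] _] := fx 0%N.
    rewrite normr_gt0; apply/negP => /eqP l0; have := D0 _ (de 0%N).
    rewrite De l0 scale0r => /(_ erefl) e0.
    by move: n1; rewrite -/(e 0%N) e0 nrm0 => /eqP; rewrite eq_sym oner_eq0.
  by rewrite /l l0 big_ord0 addr0 normr1.
(* If all moduli stayed below C, padding would be impossible beyond [N], so the later vectors would
   be orthonormal with D - lam bounded on them. The resolvent maps [z n] to e (N + n) / B, and a
   cluster point would bring two orthonormal vectors closer than 1. *)
- move=> C; have [//|noC] := pselect (exists n, C <= `|l n|).
  have lC n : `|l n| < C by rewrite ltNge; apply/negP => h; apply: noC; exists n.
  have C0 : 0 < C := le_lt_trans (normr_ge0 _) (lC 0%N).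
  pose N := Num.bound C.
  have CN n : (N <= n)%N -> nrm (e n) = 1.
    move=> Nn; have [_ _ _ [//|[_ ln]] _] := fx n.
    have := lC n; rewrite {1}/l ln ltNge => /negP[].
    rewrite ger0_norm ?addr_ge0 ?sumr_ge0 // ler_wpDr ?sumr_ge0 //.
    apply: le_trans (ltW (archi_boundP (ltW C0))) _.
    by rewrite ler_nat (leq_trans Nn).
  have [lam [K [cK _ KD]]] := cD.
  pose B := C + absc lam.
  have B0 : 0 < B by rewrite ltr_wpDr ?absc_ge0.
  have [lK _] := (bounded_opP K).1 cK.1.
  have KZ c x : K (c *: x) = c *: K x by exact: linear_mapZ.
  pose z n := (B^-1)%:C *: (D (e (N + n)%N) - lam *: e (N + n)%N).
  have z1 n : nrm (z n) <= 1.
    rewrite nrmZR ger0_norm ?invr_ge0 ?(ltW B0) // mulrC ler_pdivrMr // mul1r.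
    rewrite (le_trans (nrmD _ _)) // nrmN De nrmZR nrmZ CN ?leq_addr // !mulr1.
    by rewrite lerD2r ltW.
  have [x xP] := compact_op_cluster cK z1.
  have B2 : 0 < (2 * B)^-1 by rewrite invr_gt0 mulr_gt0.
  have [n1 _ h1] := xP _ 0%N B2; have [n2 n12 h2] := xP _ n1.+1 B2.
  have Kz n : K (z n) = (B^-1)%:C *: e (N + n)%N by rewrite KZ KD.
  have : nrm ((B^-1)%:C *: (e (N + n1)%N - e (N + n2)%N)) < B^-1.
    rewrite scalerBr -!Kz; apply: le_lt_trans (nrm_triangle x _ _) _.
    have -> : B^-1 = (2 * B)^-1 + (2 * B)^-1 by field; rewrite gt_eqF.
    by rewrite ltrD // nrmB.
  rewrite nrmZR ger0_norm ?invr_ge0 ?(ltW B0) // -{2}(mulr1 B^-1).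
  rewrite ltr_pM2l ?invr_gt0 // ltNge => /negP[].
  rewrite -ler_sqr ?nnegrE ?nrm_ge0 // expr1n (nrm_sqrD dotH) nrmN !CN ?leq_addr //.
  have [_ [oe _]] := fo (N + n2).+1.
  rewrite dotNr (oe (N + n1)%N (N + n2)%N) ?ltnS ?leq_add2l ?(ltnW n12) //.
    by rewrite oppr0 mulr0 addr0 expr1n lerDl.
  by rewrite eqn_add2l neq_ltn n12.
- by move=> n y dy yo; have [_ _ _ _] := fx n; apply.
Qed.

Variables (e : nat -> H) (l : nat -> R).
Hypothesis eb : eigenbasis e l.

Lemma eb_proj_dom n x : dom (proj e n x).
Proof. by apply: (dom_sum sD) => i; apply: (domZ sD); exact: (eb_dom eb). Qed.

Lemma op_proj n x : D (proj e n x) = diag dot e l n x.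
Proof.
rewrite /diag (op_sum sD) => [|i]; last by apply: (domZ sD); exact: (eb_dom eb).
apply: eq_bigr => i _; rewrite (opZ sD) ?(eb_eigen eb) //; last exact: (eb_dom eb).
by rewrite scalerA mul1r mulrC.
Qed.

Lemma op_proj_dom n x : dom x -> D (proj e n x) = proj e n (D x).
Proof.
move=> dx; rewrite op_proj; apply: eq_bigr => i _.
rewrite (op_sym sD) // ?(eb_eigen eb) ?dotZr ?conjc_real ?mul1r //.
exact: (eb_dom eb).
Qed.

Lemma eb_absl_gt0 i : 0 < `|l i|.
Proof. exact: lt_le_trans (eb_gt0 eb) (eb_mono eb (leq0n i)). Qed.

(** For y in the domain, the tail w of y is orthogonal to the first n vectors, so |l n| |w| <= |D w|
    <= |D y|, while |l n| is unbounded. Density of the domain and contractivity of the projections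
    give the general case. *)
Lemma proj_tends x : tends (fun n => proj e n x) x.
Proof.
have Hdom y : dom y -> tends (fun n => proj e n y) y.
  move=> dy r r0; have [N Nr] := eb_unbounded eb ((nrm (D y) + 1) / r).
  exists N => n /(eb_mono eb) Nn.
  pose w := y - proj e n y.
  have dp : dom (proj e n y) by exact: eb_proj_dom.
  have dw : dom w by exact: (domB sD).
  have wo i : (i < n)%N -> dot w (e i) = 0.
    by move=> ni; rewrite dotBl dot_diag ?mul1r ?subrr //; exact: (eb_ortho eb).
  have Dw : nrm (D w) <= nrm (D y).
    rewrite -ler_sqr ?nnegrE ?nrm_ge0 //.
    have -> : D y = D w + D (proj e n y) by rewrite -(opD sD) // subrK.
    rewrite (pythagoras dotH) ?lerDl ?sqr_ge0 // op_proj /diag dot_sumr.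
    rewrite big1 // => i _; rewrite dotZr (op_sym sD) ?(eb_eigen eb) //.
      by rewrite dotZr wo // !mulr0.
    exact: (eb_dom eb).
  have h := eb_gap eb dw wo; rewrite (nrmB (proj e n y)) -/w.
  have ln : (nrm (D y) + 1) / r <= `|l n| by apply: le_trans Nn.
  rewrite ltNge; apply/negP => rw.
  have : (nrm (D y) + 1) / r * r <= `|l n| * nrm w.
    by apply: ler_pM; rewrite ?divr_ge0 ?(ltW r0) // addr_ge0 ?nrm_ge0.
  rewrite divfK ?gt_eqF //; lra.
move=> r r0; have r3 : 0 < r / 3 by lra.
have [_ dD _] := sD; have [y dy xy] := dense_nrm x dD r3.
have [N Ny] := Hdom _ dy _ r3; exists N => n /Ny h.
have := nrm_proj_le (y - x) (eb_ortho eb n).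
rewrite diagB (nrmB y) => h2.
have := nrm_triangle (proj e n y) (proj e n x) x.
have := nrm_triangle y (proj e n y) x.
rewrite (nrmB (proj e n x) (proj e n y)) (nrmB y x); lra.
Qed.

Lemma eb_inj x y : (forall i, dot x (e i) = dot y (e i)) -> x = y.
Proof.
move=> xy; apply: (tends_unique dotH (proj_tends x)).
move=> r r0; have [N Nr] := proj_tends y r0; exists N => n /Nr.
have -> // : proj e n x = proj e n y.
by apply: eq_bigr => i _; rewrite xy.
Qed.

(** The specification of [fun_calc] ranges over all eigenvectors of D, not only those of the basis;
    this lemma lets operators that are diagonal in the basis meet it. *)
Lemma eb_eigenvector x (c : R) i : dom x -> D x = c%:C *: x ->
  dot x (e i) = 0 \/ c = l i.
Proof.
move=> dx Dx; have [<-|cl] := eqVneq c (l i); [by right|left].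
have := op_sym sD dx (eb_dom eb i).
rewrite Dx (eb_eigen eb) dotZl dotZr conjc_real => /eqP.
rewrite -subr_eq0 -mulrBl mulf_eq0 -rmorphB => /orP[|/eqP//].
rewrite -[0]/(0%:C) (inj_eq (@complexI R)) subr_eq0 => /eqP h.
by rewrite h eqxx in cl.
Qed.

End SpectralDecomposition.

(** * Bounded operators with adjoint *)

Section BoundedOperators.
Context {R : realType} {H : completeNormedModType R[i]}.
Variable dot : {dot H for (@conjC R[i])}.
Hypothesis dotH : hilbert dot.

(* Bounded operators bundled with a bounded adjoint, which spares a proof that
   adjoints exist. *)
Record bop := Bop {
  bfun :> H -> H;
  badjfun : H -> H;
  bfun_bounded : bounded_op bfun;
  badjfun_bounded : bounded_op badjfun;
  bopP : is_adjoint dot bfun badjfun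
}.

Definition bnd (T : H -> H) (M : R) := 0 <= M /\ forall x, nrm (T x) <= M * nrm x.

Lemma bounded_bnd (T : H -> H) : bounded_op T -> exists M, bnd T M.
Proof. by move=> /bounded_opP[_ [M M0 TM]]; exists M. Qed.

Lemma bnd_bounded (T : H -> H) M : linear T -> bnd T M -> bounded_op T.
Proof. by move=> lT [M0 TM]; apply/bounded_opP; split=> //; exists M. Qed.

Lemma bopDZ (X : bop) (c : R[i]) x y : X (c *: x + y) = c *: X x + X y.
Proof. exact: (bfun_bounded X).1. Qed.

Lemma bop0 (X : bop) : X 0 = 0.
Proof. exact/linear_map0/bopDZ. Qed.

Lemma bopZ (X : bop) (c : R[i]) x : X (c *: x) = c *: X x.
Proof. exact/linear_mapZ/bopDZ. Qed.

Lemma bopD (X : bop) x y : X (x + y) = X x + X y.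
Proof. by have := bopDZ X 1 x y; rewrite !scale1r. Qed.

Lemma bopB (X : bop) x y : X (x - y) = X x - X y.
Proof. exact/linear_mapB/bopDZ. Qed.

Program Definition badj (X : bop) := @Bop (badjfun X) X _ _ _.
Next Obligation. by move=> X; exact: badjfun_bounded. Qed.
Next Obligation. by move=> X; exact: bfun_bounded. Qed.
Next Obligation. by move=> X x y; rewrite (dotC dot) -bopP -(dotC dot). Qed.

Lemma bnd_adj (X : bop) M : bnd X M -> bnd (badj X) M.
Proof.
move=> [M0 XM]; split=> // y.
set z := badj X y.
have [->|z0] := eqVneq z 0; first by rewrite nrm0 mulr_ge0 ?nrm_ge0.
have nz : 0 < nrm z by rewrite lt_def nrm_eq0 z0 nrm_ge0.
rewrite -(ler_pM2l nz) -expr2 (sqr_nrm dotH) {2}/z /= -bopP.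
apply: le_trans (Re_le_absc _) _; apply: le_trans (cauchy_schwarz dotH _ _) _.
by rewrite mulrCA mulrA ler_wpM2r ?nrm_ge0.
Qed.

Lemma bndM (S T : H -> H) M N : bnd S M -> bnd T N -> bnd (S \o T) (M * N).
Proof.
move=> [M0 SM] [N0 TN]; split=> [|x /=]; first exact: mulr_ge0.
by rewrite (le_trans (SM _)) // -mulrA ler_wpM2l.
Qed.

Lemma bounded_comp (S T : H -> H) : bounded_op S -> bounded_op T ->
  bounded_op (S \o T).
Proof.
move=> bS bT; have [M SM] := bounded_bnd bS; have [N TN] := bounded_bnd bT.
by apply: bnd_bounded (bndM SM TN) => c x y /=; rewrite bT.1 bS.1.
Qed.

Lemma bounded_lin (S T : H -> H) (c : R[i]) : bounded_op S -> bounded_op T ->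
  bounded_op (c *: S + T).
Proof.
move=> bS bT; have [M [M0 SM]] := bounded_bnd bS; have [N [N0 TN]] := bounded_bnd bT.
apply: (@bnd_bounded _ (absc c * M + N)) => [a x y|].
  rewrite !fctE bT.1 bS.1 !scalerDr !scalerA (mulrC c) !addrA; congr (_ + _).
  by rewrite -!addrA; congr (_ + _); rewrite addrC.
split=> [|x]; first by rewrite addr_ge0 ?mulr_ge0 ?absc_ge0.
rewrite !fctE (le_trans (nrmD _ _)) // nrmZ mulrDl -mulrA lerD //.
by rewrite ler_wpM2l ?absc_ge0.
Qed.

Lemma bounded_zero : bounded_op (0 : H -> H).
Proof.
have zE x : (0 : H -> H) x = 0 by [].
apply: (@bnd_bounded _ 0) => [a x y|]; first by rewrite !zE scaler0 addr0.
by split=> // x; rewrite zE nrm0 mul0r.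
Qed.

Program Definition bcomp (X Y : bop) :=
  @Bop (X \o Y) (badjfun Y \o badjfun X) _ _ _.
Next Obligation. by move=> X Y; apply: bounded_comp; exact: bfun_bounded. Qed.
Next Obligation. by move=> X Y; apply: bounded_comp; exact: badjfun_bounded. Qed.
Next Obligation. by move=> X Y x y /=; rewrite !bopP. Qed.

Program Definition blin (c : R[i]) (X Y : bop) :=
  @Bop (c *: (X : H -> H) + (Y : H -> H)) (conjc c *: badjfun X + badjfun Y) _ _ _.
Next Obligation. by move=> c X Y; apply: bounded_lin; exact: bfun_bounded. Qed.
Next Obligation. by move=> c X Y; apply: bounded_lin; exact: badjfun_bounded. Qed.
Next Obligation.
move=> c X Y x y; rewrite !fctE dotDl dotZl dotDr dotZr !bopP.
by congr (_ * _ + _); case: (c) => a b /=; rewrite opprK.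
Qed.

Program Definition bzero := @Bop 0 0 _ _ _.
Next Obligation. exact: bounded_zero. Qed.
Next Obligation. exact: bounded_zero. Qed.
Next Obligation. by move=> x y; rewrite (_ : 0 x = 0) // (_ : 0 y = 0) // dot0l dot0r. Qed.

Definition badd X Y := blin 1 X Y.
Definition bsub X Y := blin (-1) Y X.

Lemma blinE c X Y x : blin c X Y x = c *: X x + Y x.
Proof. by []. Qed.

Lemma baddE X Y x : badd X Y x = X x + Y x.
Proof. by rewrite blinE scale1r. Qed.

Lemma bsubE X Y x : bsub X Y x = X x - Y x.
Proof. by rewrite blinE scaleN1r addrC. Qed.

Lemma bcompE X Y x : bcomp X Y x = X (Y x).
Proof. by []. Qed.

Lemma badj_blin c X Y x : badj (blin c X Y) x = conjc c *: badj X x + badj Y x.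
Proof. by []. Qed.

Lemma badj_bsub X Y x : badj (bsub X Y) x = badj X x - badj Y x.
Proof. by rewrite badj_blin rmorphN rmorph1 scaleN1r addrC. Qed.

Lemma adjointE (X : bop) : adjoint dot X = badjfun X.
Proof.
have [bA AX] : bounded_op (adjoint dot X) /\ is_adjoint dot X (adjoint dot X).
  rewrite /adjoint; set P := (X in xget _ X).
  suff : P (xget (fun=> 0) P) by [].
  apply: (@xgetPex _ _ P); exists (badjfun X).
  by split; [exact: badjfun_bounded|exact: bopP].
apply/funext => y; apply: (dot_inj (dot := dot)) => x.
by rewrite (dotC dot) (dotC dot (badjfun X y)) /= -AX bopP.
Qed.

Lemma bop_tends (X : bop) (u : nat -> H) x : tends u x -> tends (fun n => X (u n)) (X x).
Proof. exact: tends_bounded (bfun_bounded X). Qed.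

Lemma bounded_diag e g n : bounded_op (diag dot e g n).
Proof.
apply: (@bnd_bounded _ (\sum_(i < n) `|g i| * nrm (e i) ^+ 2)).
  by move=> c x y; exact: diagDZ.
split=> [|x]; first by apply: sumr_ge0 => i _; rewrite mulr_ge0 ?sqr_ge0.
rewrite (le_trans (nrm_sum _ _ _)) // mulr_suml ler_sum // => i _.
rewrite nrmZ.
have -> : absc ((g i)%:C * dot x (e i)) = `|g i| * absc (dot x (e i)).
  by rewrite abscM absc_real.
rewrite -!mulrA ler_wpM2l //.
have := ler_wpM2r (nrm_ge0 (e i)) (cauchy_schwarz dotH x (e i)); nra.
Qed.

Program Definition bdiag e g n := @Bop (diag dot e g n) (diag dot e g n) _ _ _.
Next Obligation. exact: bounded_diag. Qed.
Next Obligation. exact: bounded_diag. Qed.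
Next Obligation.
move=> e g n x y; rewrite /diag dot_suml dot_sumr; apply: eq_bigr => i _.
by rewrite dotZl dotZr conjcM conjc_real -(dotC dot) mulrAC.
Qed.

(** Adjoints are Cauchy at the same rate, so the limit carries a bounded adjoint too. The rate [d]
    is kept because finite rank approximants of the limit are read off from it. *)
Lemma bop_limit (X : nat -> bop) (d : nat -> R) :
  (forall e, 0 < e -> exists N, forall n, (N <= n)%N -> d n < e) ->
  (forall m n, (n <= m)%N -> bnd (bsub (X m) (X n)) (d n)) ->
  exists Y : bop, forall n, bnd (bsub Y (X n)) (d n).
Proof.
have lim (Z : nat -> H -> H) :
    (forall n, linear (Z n)) -> (exists M, bnd (Z 0%N) M) ->
    (forall e, 0 < e -> exists N, forall n, (N <= n)%N -> d n < e) ->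
    (forall m n, (n <= m)%N -> bnd (Z m - Z n) (d n)) ->
    exists Y, [/\ bounded_op Y, forall x, tends (Z ^~ x) (Y x) &
                  forall n, bnd (Y - Z n) (d n)].
  move=> lZ [M [M0 Z0]] d0 ZC.
  have /choice[Y YP] : forall x, exists y, tends (Z ^~ x) y.
    move=> x; apply: nrm_complete => e e0.
    have x1 : 0 < nrm x + 1 by rewrite ltr_wpDl ?nrm_ge0.
    have [N dN] := d0 _ (divr_gt0 e0 x1).
    have key m n : (N <= n)%N -> (n <= m)%N -> nrm (Z m x - Z n x) < e.
      move=> Nn nm; have [dn0 /(_ x)] := ZC _ _ nm; rewrite !fctE => h.
      have := dN _ Nn; rewrite ltr_pdivlMr // => h2.
      have := nrm_ge0 x; nra.
    exists N => m n Nm Nn; case/orP: (leq_total m n) => mn; last exact: key.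
    by rewrite nrmB; exact: key.
  have YZ n : bnd (Y - Z n) (d n).
    split=> [|x]; first by have [] := ZC n n (leqnn _).
    rewrite !fctE.
    have : tends (fun m => Z m x + - Z n x) (Y x + - Z n x).
      by apply: tendsD => //; exact: tends_cst.
    move=> /(tends_le (N := n)); apply => m nm.
    by have [_ /(_ x)] := ZC _ _ nm; rewrite !fctE.
  exists Y; split=> //.
  apply: (@bnd_bounded _ (d 0%N + M)) => [c x y|].
    apply: (tends_unique dotH (YP _)).
    move=> e e0.
    have h1 : bounded_op (fun z : H => c *: z).
      apply: (@bnd_bounded _ (absc c)) => [a u v|]; last first.
        by split=> [|u]; [exact: absc_ge0|rewrite nrmZ].
      by rewrite scalerDr !scalerA mulrC.
    have [N hN] := tendsD (tends_bounded h1 (YP x)) (YP y) e0.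
    by exists N => n /hN; rewrite lZ.
  have [d00 Y0] := YZ 0%N; split=> [|x]; first exact: addr_ge0.
  have -> : Y x = (Y - Z 0%N) x + Z 0%N x by rewrite !fctE subrK.
  by rewrite (le_trans (nrmD _ _)) // mulrDl lerD.
move=> d0 XC.
have XC' m n : (n <= m)%N -> bnd (bfun (X m) - bfun (X n)) (d n).
  by move=> /XC[dn h]; split=> // x; have := h x; rewrite bsubE !fctE.
have XA m n : (n <= m)%N -> bnd (badjfun (X m) - badjfun (X n)) (d n).
  move=> nm; have [dn h] := bnd_adj (XC _ _ nm); split=> // x; have := h x.
  by rewrite badj_bsub !fctE.
have [Y [bY _ YX]] := lim (fun n => bfun (X n)) (fun n => (bfun_bounded (X n)).1)
  (bounded_bnd (bfun_bounded (X 0%N))) d0 XC'.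
have [Z [bZ _ ZX]] := lim (fun n => badjfun (X n)) (fun n => (badjfun_bounded (X n)).1)
  (bounded_bnd (badjfun_bounded (X 0%N))) d0 XA.
have aYZ : is_adjoint dot Y Z.
  move=> x y; apply/eqP; rewrite -subr_eq0 -absc_eq0 eq_le absc_ge0 andbT.
  apply/ler_addgt0Pr => e e0; rewrite add0r.
  pose p := 2 * (nrm x * nrm y) + 1.
  have nxy : 0 <= nrm x * nrm y by rewrite mulr_ge0 ?nrm_ge0.
  have p0 : 0 < p by rewrite /p; lra.
  have [n /(_ n (leqnn n))] := d0 _ (divr_gt0 e0 p0); rewrite ltr_pdivlMr // => dn.
  have -> : dot (Y x) y - dot x (Z y) =
      dot ((Y - bfun (X n)) x) y - dot x ((Z - badjfun (X n)) y).
    by rewrite !fctE !dotBl !dotBr -bopP; ring.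
  rewrite -lecR -abscE (le_trans (ler_normB _ _)) // !abscE -rmorphD lecR.
  have [dn0 /(_ x) hY] := YX n; have [_ /(_ y) hZ] := ZX n.
  have h1 := cauchy_schwarz dotH ((Y - bfun (X n)) x) y.
  have h2 := cauchy_schwarz dotH x ((Z - badjfun (X n)) y).
  have h3 := ler_wpM2r (nrm_ge0 y) hY; have h4 := ler_wpM2l (nrm_ge0 x) hZ.
  rewrite /p in dn; lra.
exists (Bop bY bZ aYZ) => n; have [dn h] := YX n; split=> // x.
by have := h x; rewrite bsubE !fctE.
Qed.

End BoundedOperators.

(** * Tracial weights and their Hilbert-Schmidt form *)

Section Weights.
Context {R : realType} {H : completeNormedModType R[i]}.
Variable dot : {dot H for (@conjC R[i])}.
Hypothesis dotH : hilbert dot.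
Variable tau : (H -> H) -> \bar R.
Hypothesis tauW : tracial_weight dot tau.
Notation bop := (bop dot).
Implicit Types X Y Z : bop.

Lemma add_funE (S T : H -> H) x : (S + T) x = S x + T x. Proof. by []. Qed.
Lemma scale_funE (c : R[i]) (S : H -> H) x : (c *: S) x = c *: S x. Proof. by []. Qed.
Lemma comp_funE (S T : H -> H) x : (S \o T) x = S (T x). Proof. by []. Qed.
Lemma opp_funE (S : H -> H) x : (- S) x = - S x. Proof. by []. Qed.

Lemma positive_lin (a : R) (S T : H -> H) : 0 <= a ->
  positive_op dot S -> positive_op dot T -> positive_op dot (a%:C *: S + T).
Proof.
move=> a0 [bS pS] [bT pT]; split; first exact: bounded_lin.
move=> x; rewrite add_funE scale_funE dotDl dotZl addr_ge0 // mulr_ge0 //.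
by rewrite ler0c.
Qed.

Lemma positive_add (S T : H -> H) :
  positive_op dot S -> positive_op dot T -> positive_op dot (S + T).
Proof.
by move=> pS pT; have := @positive_lin 1 S T ler01 pS pT; rewrite scale1r.
Qed.

Lemma positive_zero : positive_op dot (0 : H -> H).
Proof.
by split; [exact: bounded_zero | move=> x; rewrite (_ : 0 x = 0) // dot0l].
Qed.

Lemma positive_scale (a : R) (S : H -> H) : 0 <= a ->
  positive_op dot S -> positive_op dot (a%:C *: S).
Proof.
by move=> a0 pS; have := positive_lin a0 pS positive_zero; rewrite addr0.
Qed.

Lemma dot_square X x : dot (badjfun X (X x)) x = (nrm (X x) ^+ 2)%:C.
Proof.
by rewrite (dotC dot) -bopP -(dotC dot) (dotxx dotH).
Qed.

Lemma positive_square X : positive_op dot (badjfun X \o X).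
Proof.
split; first by apply: bounded_comp; [exact: badjfun_bounded|exact: bfun_bounded].
by move=> x /=; rewrite dot_square ler0c sqr_ge0.
Qed.

(* [sqw X] is the squared Hilbert-Schmidt seminorm tau(X^* X), and [rsqw X] its
   real value (0 when it is infinite). *)
Definition sqw X := tau (badjfun X \o X).

Lemma tau_ge0 T : positive_op dot T -> (0 <= tau T)%E.
Proof. by have [h _ _ _] := tauW; exact: h. Qed.

Lemma tau_add S T : positive_op dot S -> positive_op dot T ->
  tau (S + T) = (tau S + tau T)%E.
Proof. by have [_ h _ _] := tauW; exact: h. Qed.

Lemma tau_scale (c : R) T : 0 <= c -> positive_op dot T ->
  tau (c%:C *: T) = (c%:E * tau T)%E.
Proof. by have [_ _ h _] := tauW; exact: h. Qed.

Lemma tau_zero : tau 0 = 0%E.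
Proof. by rewrite -(scale0r (0 : H -> H)) tau_scale ?mul0e //; exact: positive_zero. Qed.

Lemma sqw_ge0 X : (0 <= sqw X)%E.
Proof. exact/tau_ge0/positive_square. Qed.

Lemma sqw_adj X : sqw (badj X) = sqw X.
Proof.
have [_ _ _ h] := tauW; rewrite /sqw /=; symmetry; apply: h.
- exact: badjfun_bounded.
- exact: bfun_bounded.
- exact: bopP.
Qed.

(** The hypothesis says that a X^* X + b Y^* Y - Z^* Z is a positive operator. Through this lemma,
    inequalities between norms of vectors become inequalities between traces. *)
Lemma sqw_le2 (a b : R) X Y Z : 0 <= a -> 0 <= b ->
  (forall x, nrm (Z x) ^+ 2 <= a * nrm (X x) ^+ 2 + b * nrm (Y x) ^+ 2) ->
  (sqw Z <= a%:E * sqw X + b%:E * sqw Y)%E.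
Proof.
move=> a0 b0 le.
pose S : H -> H := a%:C *: (badjfun X \o X) + b%:C *: (badjfun Y \o Y).
have pS : positive_op dot S.
  by apply: positive_lin => //; [|apply: positive_scale => //]; exact: positive_square.
have pD : positive_op dot (S - (badjfun Z \o Z)).
  split.
    have -> : S - (badjfun Z \o Z) = (-1 : R[i]) *: (badjfun Z \o Z) + S.
      by rewrite scaleN1r addrC.
    by apply: bounded_lin; [exact: (positive_square Z).1|exact: pS.1].
  move=> x; rewrite /S !add_funE opp_funE !scale_funE dotDl dotNl dotDl !dotZl.
  by rewrite !dot_square -!realcM -rmorphD -rmorphB ler0c subr_ge0.
rewrite -!tau_scale //; try exact: positive_square.
rewrite -tau_add; try by apply: positive_scale => //; exact: positive_square.
rewrite -/S -(subrK (badjfun Z \o Z) S) tau_add //; last exact: positive_square.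
by rewrite leeDr // tau_ge0.
Qed.

Lemma sqw_le (a : R) X Z : 0 <= a ->
  (forall x, nrm (Z x) ^+ 2 <= a * nrm (X x) ^+ 2) -> (sqw Z <= a%:E * sqw X)%E.
Proof.
move=> a0 le; rewrite -[leRHS]adde0 -[X in (_ + X)%E](mul0e (sqw X)).
by apply: sqw_le2 => // x; rewrite mul0r addr0.
Qed.

Lemma sqw_eq X Y : (forall x, nrm (X x) = nrm (Y x)) -> sqw X = sqw Y.
Proof.
move=> XY; apply/eqP; rewrite eq_le -[leRHS]mul1e -[X in _ && (_ <= X)%E]mul1e.
by rewrite !sqw_le // => x; rewrite mul1r XY.
Qed.

Lemma sqw_compl X Z c : bnd Z c -> (sqw (bcomp Z X) <= (c ^+ 2)%:E * sqw X)%E.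
Proof.
move=> [c0 Zc]; apply: sqw_le => [|x]; first exact: sqr_ge0.
by rewrite -exprMn ler_sqr ?nnegrE ?mulr_ge0 ?nrm_ge0 // bcompE Zc.
Qed.

(** No pointwise inequality is available on this side; the trace property, in the form [sqw_adj],
    turns it into a left multiplication. *)
Lemma sqw_compr X Z c : bnd Z c -> (sqw (bcomp X Z) <= (c ^+ 2)%:E * sqw X)%E.
Proof.
move=> Zc; rewrite -(sqw_adj X) -(sqw_adj (bcomp X Z)).
rewrite (@sqw_eq _ (bcomp (badj Z) (badj X))) //.
by apply: sqw_compl; exact: bnd_adj.
Qed.

Lemma sqw_lin (c : R[i]) X Y :
  (sqw (blin c X Y) <= (2 * absc c ^+ 2)%:E * sqw X + 2%:E * sqw Y)%E.
Proof.
apply: sqw_le2 => // [|x]; first by rewrite mulr_ge0 ?sqr_ge0.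
rewrite blinE -mulrA -exprMn -nrmZ.
have := parallelogram dotH (c *: X x) (Y x); have := sqr_ge0 (nrm (c *: X x - Y x)); lra.
Qed.

Definition finw X := (sqw X < +oo)%E.

Lemma finw_lin c X Y : finw X -> finw Y -> finw (blin c X Y).
Proof.
move=> fX fY; apply: (le_lt_trans (sqw_lin _ _ _)).
apply: lte_add_pinfty; apply: lte_mul_pinfty => //.
by rewrite lee_fin mulr_ge0 // sqr_ge0.
Qed.

Lemma finw_compl X Z : finw X -> finw (bcomp Z X).
Proof.
move=> fX; have [c Zc] := bounded_bnd (bfun_bounded Z).
apply: (le_lt_trans (sqw_compl _ Zc)).
by rewrite lte_mul_pinfty // lee_fin sqr_ge0.
Qed.

Lemma finw_compr X Z : finw X -> finw (bcomp X Z).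
Proof.
move=> fX; have [c Zc] := bounded_bnd (bfun_bounded Z).
apply: (le_lt_trans (sqw_compr _ Zc)).
by rewrite lte_mul_pinfty // lee_fin sqr_ge0.
Qed.

Lemma finw_adj X : finw X -> finw (badj X).
Proof. by rewrite /finw sqw_adj. Qed.

Definition rsqw X : R := fine (sqw X).

Lemma rsqwE X : finw X -> sqw X = (rsqw X)%:E.
Proof.
by move=> fX; rewrite /rsqw fineK // ge0_fin_numE // sqw_ge0.
Qed.

Lemma rsqw_ge0 X : 0 <= rsqw X.
Proof. exact/fine_ge0/sqw_ge0. Qed.

(** Complex polarization: the vanishing quadratic form is expanded at c x + y for c = 1 and c =
    i. *)
Lemma dot_real_eq (S T : H -> H) : linear S -> linear T ->
  (forall x, dot (S x) x = dot (T x) x) -> S = T.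
Proof.
move=> lS lT ST; pose U (x : H) := S x - T x.
have UZD (c : R[i]) x y : U (c *: x + y) = c *: U x + U y.
  by rewrite /U lS lT scalerBr addrACA opprD.
have U0 x : dot (U x) x = 0 by rewrite dotBl ST subrr.
have Uxy (c : R[i]) x y : c * dot (U x) y + conjc c * dot (U y) x = 0.
  have := U0 (c *: x + y); rewrite UZD dotDl !dotDr !dotZl !dotZr !U0.
  by rewrite !mulr0 add0r addr0.
apply/funext => x; apply/eqP; rewrite -subr_eq0 -/(U x); apply/eqP.
apply: (dot_inj (dot := dot)) => y; rewrite dot0l.
have h1 := Uxy 1 x y; have h2 := Uxy 'i x y.
have i2 : 'i * 'i = -1 :> R[i] by rewrite -expr2 sqr_i.
have ci : conjc 'i = - 'i :> R[i] by apply/eqP; rewrite eq_complex /= oppr0 !eqxx.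
rewrite conjc1 !mul1r in h1; rewrite ci in h2.
have : 2 * dot (U x) y = 0.
  have -> : 2 * dot (U x) y = (dot (U x) y + dot (U y) x) -
    'i * ('i * dot (U x) y + - 'i * dot (U y) x).
    rewrite mulrDr !mulrA i2 mulrN i2; ring.
  by rewrite h1 h2 mulr0 subr0.
by move/eqP; rewrite mulf_eq0 pnatr_eq0 => /eqP.
Qed.

Lemma linear_fun_add (S T : H -> H) : linear S -> linear T -> linear (S + T).
Proof.
move=> lS lT c x y; rewrite !add_funE lS lT scalerDr !addrA; congr (_ + _).
by rewrite -!addrA; congr (_ + _); rewrite addrC.
Qed.

Lemma finite_add S T : finite_positive dot tau S -> finite_positive dot tau T ->
  finite_positive dot tau (S + T).
Proof.
move=> [pS fS] [pT fT]; split; first exact: positive_add.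
by rewrite tau_add // lte_add_pinfty.
Qed.

Lemma finite_scale (a : R) S : 0 <= a -> finite_positive dot tau S ->
  finite_positive dot tau (a%:C *: S).
Proof.
move=> a0 [pS fS]; split; first exact: positive_scale.
by rewrite tau_scale // lte_mul_pinfty // lee_fin.
Qed.

Lemma finite_zero : finite_positive dot tau 0.
Proof. by split; [exact: positive_zero | rewrite tau_zero]. Qed.

Lemma finite_fin_num S : finite_positive dot tau S -> tau S \is a fin_num.
Proof.
by move=> [pS fS]; rewrite ge0_fin_numE // tau_ge0.
Qed.

Lemma fine_add S T : finite_positive dot tau S -> finite_positive dot tau T ->
  fine (tau (S + T)) = fine (tau S) + fine (tau T).
Proof.
by move=> fS fT; rewrite tau_add ?fineD //; try exact: finite_fin_num; case: fS fT => ? _ [].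
Qed.

Lemma fine_scale (a : R) S : 0 <= a -> finite_positive dot tau S ->
  fine (tau (a%:C *: S)) = a * fine (tau S).
Proof.
by move=> a0 fS; rewrite tau_scale ?fineM //; [exact: finite_fin_num|case: fS].
Qed.

Lemma positive_Im (S : H -> H) x : positive_op dot S -> Im (dot (S x) x) = 0.
Proof. by move=> [_ pS]; apply: ger0_Im; exact: pS. Qed.

(** Positive operators have real quadratic forms, so real and imaginary parts can be compared
    separately: S1 + T2 = T1 + S2 and S3 + T4 = T3 + S4, to which additivity applies. Besides
    justifying [trace_of], this is how identities between traces are proved below: one operator is
    evaluated in two ways. *)
Lemma weight_value_unique T z w :
  weight_value dot tau T z -> weight_value dot tau T w -> z = w.
Proof.
move=> [S1 [S2 [S3 [S4 [[f1 f2 f3 f4] -> ->]]]]].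
move=> [T1 [T2 [T3 [T4 [[g1 g2 g3 g4] E ->]]]]].
have Ex x : dot (S1 x) x - dot (S2 x) x + 'i * (dot (S3 x) x - dot (S4 x) x) =
            dot (T1 x) x - dot (T2 x) x + 'i * (dot (T3 x) x - dot (T4 x) x).
  have := congr1 (fun F : H -> H => dot (F x) x) E.
  by rewrite /= !(add_funE, scale_funE, opp_funE) !dotDl !dotZl !dotDl !dotNl.
have rE S x : finite_positive dot tau S -> dot (S x) x = (Re (dot (S x) x))%:C.
  by move=> [pS _]; rewrite {1}(complexE (dot (S x) x)) positive_Im // mulr0 addr0.
have lin S : finite_positive dot tau S -> linear S by case=> [[[]]].
have /all_and2[E1 E2] : forall x,
    dot ((S1 + T2) x) x = dot ((T1 + S2) x) x /\
    dot ((S3 + T4) x) x = dot ((T3 + S4) x) x.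
  move=> x; rewrite !add_funE !dotDl; have := Ex x.
  rewrite (rE S1) // (rE S2) // (rE S3) // (rE S4) // (rE T1) // (rE T2) //.
  rewrite (rE T3) // (rE T4) // -!rmorphD -!rmorphB => /eqP.
  rewrite eq_complex /= => /andP[/eqP h1 /eqP h2].
  by split; congr (_%:C); lra.
have {}E1 : S1 + T2 = T1 + S2.
  by apply: dot_real_eq E1; apply: linear_fun_add; exact: lin.
have {}E2 : S3 + T4 = T3 + S4.
  by apply: dot_real_eq E2; apply: linear_fun_add; exact: lin.
have := congr1 (fun F => fine (tau F)) E1; rewrite /= !fine_add // => h1.
have := congr1 (fun F => fine (tau F)) E2; rewrite /= !fine_add // => h2.
by congr (_%:C + 'i * _%:C); lra.
Qed.

Lemma trace_ofE T z : weight_value dot tau T z -> trace_of dot tau T = z.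
Proof.
move=> Tz; rewrite /trace_of; set P := (X in xget _ X).
have : P (xget 0 P) by apply: xgetPex; exists z.
by move=> h; exact: weight_value_unique h Tz.
Qed.

Lemma weight_value_add S T z w :
  weight_value dot tau S z -> weight_value dot tau T w ->
  weight_value dot tau (S + T) (z + w).
Proof.
move=> [S1 [S2 [S3 [S4 [[f1 f2 f3 f4] -> ->]]]]].
move=> [T1 [T2 [T3 [T4 [[g1 g2 g3 g4] -> ->]]]]].
exists (S1 + T1), (S2 + T2), (S3 + T3), (S4 + T4); split.
- by split; exact: finite_add.
- apply/funext => x; apply: (dot_inj (dot := dot)) => y;
  rewrite !(add_funE, scale_funE, opp_funE) !(dotDl, dotZl, dotNl); ring.
- by rewrite !fine_add // !(rmorphD, rmorphB) /=; ring.
Qed.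

Lemma weight_value_real (a : R) S z : weight_value dot tau S z ->
  weight_value dot tau (a%:C *: S) (a%:C * z).
Proof.
have pos (b : R) : 0 <= b -> forall S z, weight_value dot tau S z ->
    weight_value dot tau (b%:C *: S) (b%:C * z).
  move=> b0 {}S {}z [S1 [S2 [S3 [S4 [[f1 f2 f3 f4] -> ->]]]]].
  exists (b%:C *: S1), (b%:C *: S2), (b%:C *: S3), (b%:C *: S4); split.
  - by split; exact: finite_scale.
  - apply/funext => x; apply: (dot_inj (dot := dot)) => y;
  rewrite !(add_funE, scale_funE, opp_funE) !(dotDl, dotZl, dotNl); ring.
  - by rewrite !fine_scale // !(rmorphB, rmorphM) /=; ring.
have [a0|a0] := leP 0 a; first exact: pos.
move=> /(pos (- a)); rewrite oppr_ge0 => /(_ (ltW a0)).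
move=> [S1 [S2 [S3 [S4 [[f1 f2 f3 f4] E1 E2]]]]].
exists S2, S1, S4, S3; split=> //.
- rewrite -(opprK (a%:C *: S)) -scaleNr -rmorphN E1.
  apply/funext => x; apply: (dot_inj (dot := dot)) => y;
  rewrite !(add_funE, scale_funE, opp_funE) !(dotDl, dotZl, dotNl); ring.
- by rewrite -(opprK (a%:C * z)) -mulNr -rmorphN E2 !rmorphB /=; ring.
Qed.

Lemma weight_value_i S z : weight_value dot tau S z ->
  weight_value dot tau ('i *: S) ('i * z).
Proof.
have i2 : 'i * 'i = -1 :> R[i] by rewrite -expr2 sqr_i.
move=> [S1 [S2 [S3 [S4 [[f1 f2 f3 f4] -> ->]]]]].
exists S4, S3, S1, S2; split=> //.
- by rewrite scalerDr scalerA i2 scaleN1r opprB addrC.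
- by rewrite mulrDr mulrA i2 mulN1r -rmorphN opprB addrC.
Qed.

Lemma weight_value_lin (c : R[i]) S T z w :
  weight_value dot tau S z -> weight_value dot tau T w ->
  weight_value dot tau (c *: S + T) (c * z + w).
Proof.
move=> Sz; apply: weight_value_add.
rewrite (complexE c) scalerDl mulrDl -scalerA -mulrA.
apply: weight_value_add; first exact: weight_value_real.
by apply: weight_value_i; exact: weight_value_real.
Qed.

(* The value of [tau] at [Y^* X], by polarization. *)
Definition ip X Y : R[i] :=
  ((rsqw (badd X Y) - rsqw (bsub X Y)) / 4)%:C +
  'i * ((rsqw (badd X (blin 'i Y (bzero dot)))
         - rsqw (bsub X (blin 'i Y (bzero dot)))) / 4)%:C.

End Weights.

(** * The polarized trace form *)

Section WeightInnerProduct.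
Context {R : realType} {H : completeNormedModType R[i]}.
Variable dot : {dot H for (@conjC R[i])}.
Hypothesis dotH : hilbert dot.
Variable tau : (H -> H) -> \bar R.
Hypothesis tauW : tracial_weight dot tau.
Notation bop := (bop dot).
Implicit Types X Y Z : bop.
Notation iY Y := (blin 'i Y (bzero dot)).

Let i2 : 'i * 'i = -1 :> R[i].
Proof. by rewrite -expr2 sqr_i. Qed.

Let ci : conjc 'i = - 'i :> R[i].
Proof. by apply/eqP; rewrite eq_complex /= oppr0 !eqxx. Qed.

Let absc_i : absc ('i : R[i]) = 1.
Proof.
apply/eqP; rewrite -(@eqrXn2 _ 2) ?absc_ge0 // sqr_abscE /= expr0n expr1n.
by rewrite add0r.
Qed.

Let nrm_i (x : H) : nrm ('i *: x) = nrm x.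
Proof. by rewrite nrmZ absc_i mul1r. Qed.

Lemma iYE Y x : iY Y x = 'i *: Y x.
Proof. by rewrite blinE (_ : bzero dot x = 0) // addr0. Qed.

Lemma rsqw_eq X Y : (forall x, nrm (X x) = nrm (Y x)) -> rsqw tau X = rsqw tau Y.
Proof. by move=> XY; rewrite /rsqw (sqw_eq dotH tauW XY). Qed.

Lemma rsqw_adj X : rsqw tau (badj X) = rsqw tau X.
Proof. by rewrite /rsqw sqw_adj. Qed.

Lemma dot_badj X x y : dot (badjfun X x) y = dot x (X y).
Proof. by rewrite (dotC dot) -bopP -(dotC dot). Qed.

Lemma finw_zero : finw tau (bzero dot).
Proof.
have E : badjfun (bzero dot) \o bzero dot = 0 by [].
by rewrite /finw /sqw E (tau_zero tauW).
Qed.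

Lemma finite_square X : finw tau X -> finite_positive dot tau (badjfun X \o X).
Proof. by split; [exact: positive_square|]. Qed.

Lemma weight_value_ip X Y : finw tau X -> finw tau Y ->
  weight_value dot tau (badjfun Y \o X) (ip tau X Y).
Proof.
move=> fX fY; pose sq Z : H -> H := badjfun Z \o Z.
have fi : finw tau (iY Y) by apply: (finw_lin dotH tauW) => //; exact: finw_zero.
have f1 : finw tau (badd X Y) by apply: (finw_lin dotH tauW).
have f2 : finw tau (bsub X Y) by apply: (finw_lin dotH tauW).
have f3 : finw tau (badd X (iY Y)) by apply: (finw_lin dotH tauW).
have f4 : finw tau (bsub X (iY Y)) by apply: (finw_lin dotH tauW).
have q0 : 0 <= 4^-1 :> R by rewrite invr_ge0.
exists ((4^-1)%:C *: sq (badd X Y)), ((4^-1)%:C *: sq (bsub X Y)),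
  ((4^-1)%:C *: sq (badd X (iY Y))), ((4^-1)%:C *: sq (bsub X (iY Y))); split.
- by split; apply: (finite_scale tauW) => //; exact: finite_square.
- apply/funext => x; apply: (dot_inj (dot := dot)) => y.
  have sqE Z : dot (((4^-1)%:C *: sq Z) x) y = 4^-1 * dot (Z x) (Z y).
    by rewrite scale_funE dotZl /sq comp_funE dot_badj fmorphV rmorph_nat.
  have key (T1 T2 T3 T4 : H -> H) : dot ((T1 - T2 + 'i *: (T3 - T4)) x) y =
      dot (T1 x) y - dot (T2 x) y + 'i * (dot (T3 x) y - dot (T4 x) y).
    by rewrite !(add_funE, scale_funE, opp_funE) !(dotDl, dotZl, dotNl).
  rewrite key !sqE !(bsubE, baddE, iYE) comp_funE dot_badj.
  rewrite !(dotDl, dotDr, dotNl, dotNr, dotZl, dotZr) ci.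
  set a := dot (X x) (X y); set b := dot (X x) (Y y).
  set c := dot (Y x) (X y); set d := dot (Y x) (Y y).
  transitivity ((b + c) / 2 + ('i * 'i) * (c - b) / 2).
    by rewrite i2; field.
  by field.
- rewrite !(fine_scale tauW) //; try exact: finite_square.
  rewrite /ip -/(rsqw tau _).
  by congr (_%:C + 'i * _%:C); rewrite /rsqw /sqw -/(sq _); ring.
Qed.

(** This is the trace property in polarized form: the seminorm is invariant under adjoints, and each
    of the four squares is matched up to a factor of modulus 1. *)
Lemma ip_adj X Y : ip tau (badj Y) (badj X) = ip tau X Y.
Proof.
rewrite /ip -(rsqw_adj (badd X Y)) -(rsqw_adj (bsub X Y)).
rewrite -(rsqw_adj (badd X (iY Y))) -(rsqw_adj (bsub X (iY Y))).
congr (((_ - _) / 4)%:C + 'i * ((_ - _) / 4)%:C); apply: rsqw_eq => x.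
- by rewrite baddE badj_blin conjc1 scale1r addrC.
- by rewrite bsubE badj_bsub nrmB.
- rewrite baddE iYE -[RHS]nrm_i; congr nrm.
  rewrite badj_blin badj_blin conjc1 scale1r scalerDr addrC ci.
  rewrite (_ : badj (bzero dot) x = 0) // addr0 scaleNr scalerN scalerA i2.
  by rewrite scaleN1r opprK.
- rewrite bsubE iYE -[RHS]nrm_i -nrmN; congr nrm.
  rewrite badj_bsub badj_blin scalerBr opprB ci.
  rewrite (_ : badj (bzero dot) x = 0) // addr0 scaleNr scalerN scalerA i2.
  by rewrite scaleN1r opprK.
Qed.

Lemma weight_value_ipC X Y : finw tau X -> finw tau Y ->
  weight_value dot tau (X \o badjfun Y) (ip tau X Y).
Proof.
move=> fX fY; rewrite -ip_adj.
by apply: (@weight_value_ip (badj Y) (badj X)); rewrite /finw sqw_adj.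
Qed.

Lemma ip_conj X Y : ip tau Y X = conjc (ip tau X Y).
Proof.
rewrite /ip; have -> : rsqw tau (badd Y X) = rsqw tau (badd X Y).
  by apply: rsqw_eq => x; rewrite !baddE addrC.
have -> : rsqw tau (bsub Y X) = rsqw tau (bsub X Y).
  by apply: rsqw_eq => x; rewrite !bsubE nrmB.
have -> : rsqw tau (badd Y (iY X)) = rsqw tau (bsub X (iY Y)).
  apply: rsqw_eq => x; rewrite baddE bsubE !iYE -[RHS]nrm_i.
  by rewrite scalerBr scalerA i2 scaleN1r opprK addrC.
have -> : rsqw tau (bsub Y (iY X)) = rsqw tau (badd X (iY Y)).
  apply: rsqw_eq => x; rewrite baddE bsubE !iYE -[RHS]nrm_i.
  by rewrite scalerDr scalerA i2 scaleN1r nrmB.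
apply/eqP; rewrite eq_complex /=; apply/andP; split; apply/eqP; ring.
Qed.

Lemma weight_value_square X : finw tau X ->
  weight_value dot tau (badjfun X \o X) (rsqw tau X)%:C.
Proof.
move=> fX; exists (badjfun X \o X), 0, 0, 0; split.
- by split; try exact: (finite_zero tauW); exact: finite_square.
- by rewrite !subr0 scaler0 addr0.
- by rewrite (tau_zero tauW) /= !subr0 mulr0 addr0.
Qed.

(** Sesquilinearity of [ip] is not established from its formula; the expansion comes from evaluating
    the operator (c Y + X)^* (c Y + X) in two ways. *)
Lemma rsqw_blin (c : R[i]) X Y : finw tau X -> finw tau Y ->
  rsqw tau (blin c Y X) = rsqw tau X + 2 * Re (c * ip tau Y X) + absc c ^+ 2 * rsqw tau Y.
Proof.
move=> fX fY.
have h1 := weight_value_square (finw_lin dotH tauW c fY fX).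
have h2 := weight_value_lin tauW c (weight_value_ip fY fX)
  (weight_value_lin tauW (conjc c) (weight_value_ip fX fY)
    (weight_value_lin tauW ((absc c ^+ 2)%:C) (weight_value_square fY)
      (weight_value_square fX))).
have E : badjfun (blin c Y X) \o blin c Y X = c *: (badjfun X \o Y) +
    (conjc c *: (badjfun Y \o X) +
     ((absc c ^+ 2)%:C *: (badjfun Y \o Y) + (badjfun X \o X))).
  apply/funext => x; apply: (dot_inj (dot := dot)) => y.
  rewrite [in LHS]comp_funE [in LHS]dot_badj !blinE.
  rewrite !(add_funE, scale_funE) !comp_funE !(dotDl, dotZl) !dot_badj.
  rewrite !(dotDl, dotDr, dotZl, dotZr) sqr_absc.
  by ring.
rewrite E in h1; have := congr1 (@complex.Re R) (weight_value_unique tauW h1 h2).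
have ReR (r : R) : Re r%:C = r by [].
have ReJ (z : R[i]) : Re (conjc z) = Re z by case: z.
rewrite !ReD -realcM !ReR (ip_conj Y X) -conjcM ReJ => ->; ring.
Qed.

Lemma ip_cauchy_schwarz X Y : finw tau X -> finw tau Y ->
  absc (ip tau Y X) ^+ 2 <= rsqw tau X * rsqw tau Y.
Proof.
move=> fX fY; apply: quadratic_bound => [|c]; first exact: rsqw_ge0.
by rewrite -rsqw_blin //; exact: rsqw_ge0.
Qed.

Lemma ip_null X Y : finw tau X -> finw tau Y -> rsqw tau Y = 0 -> ip tau X Y = 0.
Proof.
move=> fX fY Y0; have := ip_cauchy_schwarz fY fX.
rewrite Y0 mul0r => h; apply/eqP; rewrite -absc_eq0 -sqrf_eq0.
by rewrite eq_le h sqr_ge0.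
Qed.

End WeightInnerProduct.

(** * Commutators with powers of |D| *)

Section Coefficients.
Context {R : realType} {H : completeNormedModType R[i]}.
Variable dot : {dot H for (@conjC R[i])}.
Hypothesis dotH : hilbert dot.
Variables (dom : set H) (D : H -> H).
Hypothesis sD : self_adjoint dot dom D.
Variables (e : nat -> H) (l : nat -> R).
Hypothesis eb : eigenbasis dot dom D e l.
Notation bop := (bop dot).
Notation proj n := (bdiag dotH e (fun=> 1) n).

(** The spectral projection on the indices a <= i < b; the upper limit is the truncation index of
    [bdiag]. *)
Definition band a b : bop := bdiag dotH e (fun i => (a <= i)%N%:R) b.

Lemma coef_diag g n x j :
  dot (bdiag dotH e g n x) (e j) = (if (j < n)%N then g j else 0)%:C * dot x (e j).
Proof.
case: ltnP => [jn|nj]; first by rewrite dot_diag //; exact: (eb_ortho eb).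
rewrite mul0r /= /diag dot_suml big1 // => i _; rewrite dotZl.
have [oe _] := eb_ortho eb j.+1.
rewrite oe ?mulr0 // ?ltnS ?(leq_trans (ltnW (ltn_ord i))) //.
by rewrite neq_ltn (leq_trans (ltn_ord i)).
Qed.

Lemma diag_eq g n h m x :
  (forall j, (if (j < n)%N then g j else 0) = (if (j < m)%N then h j else 0)) ->
  bdiag dotH e g n x = bdiag dotH e h m x.
Proof.
move=> gh; apply: (eb_inj dotH sD eb) => j; rewrite !coef_diag.
by congr (_%:C * _).
Qed.

Lemma diag_comp g n h m x :
  bdiag dotH e g n (bdiag dotH e h m x) = bdiag dotH e (fun j => g j * h j) (minn n m) x.
Proof.
apply: (eb_inj dotH sD eb) => j; rewrite !coef_diag mulrA -realcM leq_min.
by congr (_%:C * _); case: (j < n)%N; case: (j < m)%N; rewrite ?(mulr0, mul0r).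
Qed.

Lemma bandE a b x : (a <= b)%N -> band a b x = proj b x - proj a x.
Proof.
move=> ab; apply: (eb_inj dotH sD eb) => j; rewrite dotBl !coef_diag -mulrBl -rmorphB.
congr (_%:C * _); case: (ltnP j a) => [ja|aj].
  by rewrite (leq_trans ja ab) subrr.
by case: ltnP; rewrite subr0.
Qed.

Definition coef2 (x : H) i := absc (dot x (e i)) ^+ 2.

Lemma coef2_ge0 x i : 0 <= coef2 x i. Proof. exact: sqr_ge0. Qed.

Lemma nrm_bdiag g n x :
  nrm (bdiag dotH e g n x) ^+ 2 = \sum_(0 <= i < n) g i ^+ 2 * coef2 x i.
Proof. by rewrite (nrm_diag dotH) ?big_mkord //; exact: (eb_ortho eb). Qed.

Lemma nrm_diag_le g h n x : (forall i, (i < n)%N -> `|g i| <= `|h i|) ->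
  nrm (bdiag dotH e g n x) <= nrm (bdiag dotH e h n x).
Proof.
move=> gh; rewrite -ler_sqr ?nnegrE ?nrm_ge0 // !nrm_bdiag !big_mkord.
apply: ler_sum => i _; rewrite ler_wpM2r ?coef2_ge0 //.
by rewrite -(real_normK (num_real (g i))) -(real_normK (num_real (h i))) ler_sqr
  ?nnegrE ?gh.
Qed.

Lemma diag_scale g c n x :
  bdiag dotH e (fun i => c * g i) n x = c%:C *: bdiag dotH e g n x.
Proof.
rewrite /= /diag scaler_sumr; apply: eq_bigr => i _.
by rewrite scalerA realcM mulrA.
Qed.

Lemma nrm_projle n x : nrm (proj n x) <= nrm x.
Proof. by apply: nrm_proj_le => //; exact: (eb_ortho eb). Qed.

Lemma nrm_diag_bound g n x (M : R) : 0 <= M ->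
  (forall i, (i < n)%N -> `|g i| <= M) -> nrm (bdiag dotH e g n x) <= M * nrm x.
Proof.
move=> M0 gM; apply: (@le_trans _ _ (nrm (bdiag dotH e (fun=> M * 1) n x))).
  by apply: nrm_diag_le => i ni; rewrite mulr1 (ger0_norm M0) gM.
by rewrite diag_scale nrmZR ger0_norm // ler_wpM2l // nrm_projle.
Qed.

Lemma nrm_band_le a b x : nrm (band a b x) <= nrm x.
Proof.
by rewrite -[leRHS]mul1r nrm_diag_bound // => i _; case: leq; rewrite ?normr1 ?normr0.
Qed.

Lemma nrm_band a b x : (a <= b)%N ->
  nrm (band a b x) ^+ 2 = \sum_(a <= i < b) coef2 x i.
Proof.
move=> ab; rewrite nrm_bdiag (big_cat_nat (leq0n a) ab) /= big1_seq ?add0r.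
  rewrite big_nat [RHS]big_nat; apply: eq_bigr => i /andP[ai _].
  by rewrite ai expr1n mul1r.
move=> i; rewrite mem_index_iota => /andP[_ /andP[_ ia]].
by rewrite leqNgt ia expr0n mul0r.
Qed.

Lemma coprojle n x : nrm (x - proj n x) <= nrm x.
Proof.
pose p := proj n x; have o : dot (x - p) p = 0.
  rewrite {2}/p /= /diag dot_sumr big1 // => i _.
  by rewrite dotZr dotBl /p coef_diag ltn_ord mul1r subrr mulr0.
rewrite -ler_sqr ?nnegrE ?nrm_ge0 // -[in leRHS](subrK p x) (pythagoras dotH o).
by rewrite lerDl sqr_ge0.
Qed.

Lemma sum_coef2_le x n : \sum_(0 <= i < n) coef2 x i <= nrm x ^+ 2.
Proof.
by rewrite -nrm_band // ler_sqr ?nnegrE ?nrm_ge0 // nrm_band_le.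
Qed.

Lemma nrm_le_coef2 x (B : R) (k : nat -> nat) : (forall n, exists m, (n <= k m)%N) ->
  (forall n, \sum_(0 <= i < k n) coef2 x i <= B) -> nrm x ^+ 2 <= B.
Proof.
move=> kn le; have B0 : 0 <= B.
  by apply: le_trans (le 0%N); rewrite sumr_ge0 // => i _; exact: coef2_ge0.
rewrite -(sqr_sqrtr B0) ler_sqr ?nnegrE ?nrm_ge0 ?sqrtr_ge0 //.
apply: (tends_le (N := 0%N) (proj_tends dotH sD eb x)) => n _.
rewrite -ler_sqr ?nnegrE ?nrm_ge0 ?sqrtr_ge0 // sqr_sqrtr //.
have [m nm] := kn n; apply: le_trans (le m); rewrite (nrm_bdiag (fun=> 1)).
rewrite [leRHS](big_cat_nat (leq0n n) nm) /= -[leLHS]addr0 lerD //.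
  by apply: ler_sum => i _; rewrite expr1n mul1r.
by rewrite sumr_ge0 // => i _; exact: coef2_ge0.
Qed.

(** As g is nonincreasing, the part of the diagonal beyond n has norm at most g n, so the
    truncations converge in norm. This constructs the powers of |D|^-1. *)
Lemma diag_limit (g : nat -> R) : (forall i, 0 <= g i) ->
  {homo g : m n / (m <= n)%N >-> n <= m} -> (forall r, 0 < r -> exists n, g n < r) ->
  exists S : bop, forall x j, dot (S x) (e j) = (g j)%:C * dot x (e j).
Proof.
move=> g0 gm gl.
have gN r : 0 < r -> exists N, forall n, (N <= n)%N -> g n < r.
  by move=> /gl[N Nr]; exists N => n /gm h; exact: le_lt_trans Nr.
have [m n nm|S SP] := @bop_limit _ _ _ dotH (fun n => bdiag dotH e g n) g gN.
  split=> // x; rewrite bsubE.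
  have -> : bdiag dotH e g m x - bdiag dotH e g n x =
            bdiag dotH e (fun i => (n <= i)%N%:R * g i) m x.
    apply: (eb_inj dotH sD eb) => j; rewrite dotBl !coef_diag -mulrBl -rmorphB.
    congr (_%:C * _); case: (ltnP j n) => [jn|nj].
      by rewrite (leq_trans jn nm) subrr mul0r.
    by case: ltnP; rewrite subr0 ?mul1r.
  apply: nrm_diag_bound => // i im; case: leqP => ni.
    by rewrite mul1r ger0_norm // gm.
  by rewrite mul0r normr0.
exists S => x j.
have xS : tends (fun n => bdiag dotH e g n x) (S x).
  move=> r r0; have x1 : 0 < nrm x + 1 by rewrite ltr_wpDl ?nrm_ge0.
  have [N gr] := gN _ (divr_gt0 r0 x1); exists N => n /gr.
  rewrite ltr_pdivlMr // nrmB; have [_ /(_ x)] := SP n; rewrite bsubE.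
  have := nrm_ge0 x; have := g0 n; nra.
apply: (tends_dotl dotH xS); exists j.+1 => n jn.
by rewrite coef_diag jn.
Qed.

Lemma basis_eigen (X : bop) (g : nat -> R) j :
  (forall x i, dot (X x) (e i) = (g i)%:C * dot x (e i)) -> X (e j) = (g j)%:C *: e j.
Proof.
move=> Xg; apply: (eb_inj dotH sD eb) => i; rewrite Xg dotZl.
have [->//|ij] := eqVneq i j.
have [oe _] := eb_ortho eb (maxn i j).+1.
by rewrite oe ?mulr0 // ?ltnS ?leq_maxl ?leq_maxr // eq_sym.
Qed.

Lemma coef_adj (S : bop) (g : nat -> R) :
  (forall x j, dot (S x) (e j) = (g j)%:C * dot x (e j)) ->
  forall x, badj S x = S x.
Proof.
move=> Sg x; apply: (eb_inj dotH sD eb) => j; rewrite Sg.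
by rewrite /= dot_badj (basis_eigen j Sg) dotZr conjc_real.
Qed.

(* With [P] the spectral projection on the part where |D| <= t and [Q] the one
   where |D| >= u, the operator [X = Q b P] solves [D X - X D = Q [D, b] P]; hence
   u |X| <= M + t |X|, where |X| is the least bound of [X]. *)
Lemma sylvester (b : bop) (M t u : R) n1 n2 :
  (forall x, dom x -> dom (b x)) ->
  (forall x, dom x -> nrm (D (b x) - b (D x)) <= M * nrm x) ->
  0 <= M -> 0 <= t -> t < u ->
  (forall i, (i < n1)%N -> `|l i| <= t) -> u <= `|l n2| ->
  forall x, nrm (b (proj n1 x) - proj n2 (b (proj n1 x))) <= M / (u - t) * nrm x.
Proof.
move=> bdom bM M0 t0 tu lt lu.
pose X x := b (proj n1 x) - proj n2 (b (proj n1 x)).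
have u0 : 0 < u by exact: le_lt_trans tu.
have dproj n y : dom (proj n y) by exact: (eb_proj_dom sD eb).
have step c : bnd X c -> bnd X ((M + t * c) / u).
  move=> [c0 Xc]; split=> [|x]; first by rewrite divr_ge0 ?(ltW u0) // addr_ge0 ?mulr_ge0.
  have dbp : dom (b (proj n1 x)) by exact: bdom.
  have dX : dom (X x) by exact: (domB sD).
  have Xo i : (i < n2)%N -> dot (X x) (e i) = 0.
    by move=> ni; rewrite dotBl coef_diag ni mul1r subrr.
  have h1 := eb_gap eb dX Xo.
  have h2 : u * nrm (X x) <= `|l n2| * nrm (X x) by rewrite ler_wpM2r ?nrm_ge0.
  pose z := diag dot e l n1 x.
  have Dz : D (proj n1 x) = z by exact: (op_proj sD eb).
  have zz : proj n1 z = z.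
    have := diag_comp (fun=> 1) n1 l n1 x; rewrite /= -/z => ->.
    by rewrite minnn; apply: eq_bigr => i _; rewrite mul1r.
  pose r := D (b (proj n1 x)) - b (D (proj n1 x)).
  have DX : D (X x) = X z + (r - proj n2 r).
    rewrite /X (opB sD) // (op_proj_dom sD eb) // zz /r Dz bopB.
    have alg (a a' c' d : H) : a - a' = c' - d + (a - c' - (a' - d)).
      by apply: (dot_inj (dot := dot)) => w; rewrite !(dotDl, dotNl); ring.
    exact: alg.
  have h3 : nrm (r - proj n2 r) <= M * nrm x.
    rewrite (le_trans (coprojle _ _)) // (le_trans (bM _ (dproj _ _))) //.
    by rewrite ler_wpM2l // nrm_projle.
  have h4 : nrm (X z) <= t * c * nrm x.
    rewrite (le_trans (Xc z)) // (mulrC t) -mulrA ler_wpM2l //.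
    by apply: (nrm_diag_bound (g := l)).
  have h5 := nrmD (X z) (r - proj n2 r); rewrite -DX in h5.
  by rewrite mulrAC ler_pdivlMr // mulrC mulrDl; lra.
pose B := [set c | bnd X c].
have B0 : B !=set0.
  have [c [c0 bc]] := bounded_bnd (bfun_bounded b); exists c; split=> // x.
  by rewrite (le_trans (coprojle _ _)) // (le_trans (bc _)) // ler_wpM2l // nrm_projle.
have lB : lbound B 0 by move=> c [].
(* The infimum of the bounds is itself a bound, so [step] applies to it and gives an inequality that
   can be solved for [inf B]. *)
have iB : B (inf B).
  split=> [|x]; first exact: lb_le_inf.
  have [->|x0] := eqVneq x 0.
    by rewrite /X !bop0 subrr nrm0 mulr0.
  have nx : 0 < nrm x by rewrite lt_def nrm_eq0 x0 nrm_ge0.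
  rewrite -ler_pdivrMr //; apply: lb_le_inf => // c [_ /(_ x)].
  by rewrite ler_pdivrMr.
have : inf B <= (M + t * inf B) / u.
  by apply: ge_inf; [exists 0|exact: step].
rewrite ler_pdivlMr // => h x; have [_ /(_ x) hX] := iB.
rewrite (le_trans hX) // ler_wpM2r ?nrm_ge0 // ler_pdivlMr ?subr_gt0 //; lra.
Qed.

End Coefficients.

(** * Removing the entries between nonadjacent blocks *)

Section Tridiagonal.
Context {R : realType} {H : completeNormedModType R[i]}.
Variable dot : {dot H for (@conjC R[i])}.
Hypothesis dotH : hilbert dot.
Variables (dom : set H) (D : H -> H).
Hypothesis sD : self_adjoint dot dom D.
Variables (e : nat -> H) (l : nat -> R).
Hypothesis eb : eigenbasis dot dom D e l.
Notation bop := (bop dot).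
Notation band := (band dotH e).

Lemma band_band a b c d x :
  band a b (band c d x) = band (maxn a c) (minn b d) x.
Proof.
rewrite /band (diag_comp dotH sD eb); apply: (diag_eq dotH sD eb) => j.
by rewrite geq_max -natrM mulnb.
Qed.

Lemma band_empty a b x : (b <= a)%N -> band a b x = 0.
Proof.
move=> ba; apply: (eb_inj dotH sD eb) => j; rewrite dot0l (coef_diag dotH eb).
case: ltnP => [jb|]; last by rewrite mul0r.
by rewrite leqNgt (leq_trans jb ba) mul0r.
Qed.

Lemma band_sub a b c d x : (c <= a)%N -> (b <= d)%N ->
  band a b (band c d x) = band a b x.
Proof. by move=> ca bd; rewrite band_band (maxn_idPl ca) (minn_idPl bd). Qed.

Lemma band_disjoint a b c d x : (b <= c)%N || (d <= a)%N ->
  band a b (band c d x) = 0.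
Proof.
move=> h; rewrite band_band band_empty //; case/orP: h => h.
  by rewrite (leq_trans (geq_minl b d)) // (leq_trans h) // leq_maxr.
by rewrite (leq_trans (geq_minr b d)) // (leq_trans h) // leq_maxl.
Qed.

Lemma geometric_small (q c : R) : 0 < q < 1 -> 0 <= c -> forall r, 0 < r ->
  exists N, forall n, (N <= n)%N -> c * q ^+ n < r.
Proof.
move=> /andP[q0 q1] c0 r r0.
have c1 : 0 < c + 1 by rewrite ltr_wpDl.
have q1' : `|q| < 1 by rewrite ger0_norm // ltW.
have /cvgr0Pnorm_lt/(_ _ (divr_gt0 r0 c1))[N _ Nr] := cvg_expr q1'.
exists N => n /Nr /=; rewrite ger0_norm ?exprn_ge0 ?(ltW q0) // ltr_pdivlMr //.
have := exprn_ge0 n (ltW q0); nra.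
Qed.

Variables (a q : R).
Hypothesis aE : a = `|l 0%N|.
Hypothesis q01 : 0 < q < 1.
Let q0 : 0 < q. Proof. by case/andP: q01. Qed.
Let q1 : q < 1. Proof. by case/andP: q01. Qed.
Let a0 : 0 < a. Proof. by rewrite aE; exact: (eb_gt0 eb). Qed.

(* The spectrum of |D| is cut at the geometric sequence [a / q ^ m], with [q] close
   to 1; [k m] is the number of eigenvalues below the m-th cut, and [E m] is the
   spectral projection on the block between two consecutive cuts. *)
Definition cutoff m := a / q ^+ m.

Lemma cutoff_gt0 m : 0 < cutoff m.
Proof. by rewrite divr_gt0 // exprn_gt0. Qed.

Lemma cutoffS m : cutoff m = q * cutoff m.+1.
Proof.
have qn : q ^+ m != 0 by rewrite expf_neq0 // gt_eqF.
by rewrite /cutoff exprS; field; rewrite ?qn ?(gt_eqF q0).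
Qed.

Lemma cutoff_lt m : cutoff m < cutoff m.+1.
Proof. by rewrite cutoffS gtr_pMl // cutoff_gt0. Qed.

Lemma blocks_exist : exists k : nat -> nat,
  [/\ k 0%N = 0%N, {homo k : m n / (m <= n)%N},
      forall m i, (i < k m)%N -> `|l i| < cutoff m,
      forall m, cutoff m <= `|l (k m)|
    & forall n, exists m, (n <= k m)%N].
Proof.
have ex m : exists n, cutoff m <= `|l n| by exact: (eb_unbounded eb).
pose k m := ex_minn (ex m).
have kle m : cutoff m <= `|l (k m)| by rewrite /k; case: ex_minnP.
have klt m i : (i < k m)%N -> `|l i| < cutoff m.
  rewrite /k; case: ex_minnP => n _ nmin; rewrite ltNge; apply: contraL.
  by move=> /nmin; rewrite leqNgt.
exists k; split=> //.
- apply/eqP; rewrite -leqn0 leqNgt; apply/negP => /klt.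
  by rewrite /cutoff expr0 divr1 aE ltxx.
- apply/nondecreasing_seqP => m; rewrite leEnat leqNgt; apply/negP => /klt.
  by rewrite ltNge (le_trans (ltW (cutoff_lt m))).
- move=> n; have c0 : 0 <= `|l n| by [].
  have [N /(_ N (leqnn N)) h] := geometric_small q01 c0 a0.
  exists N; rewrite leqNgt; apply/negP => kn.
  have := kle N; apply/negP; rewrite -ltNge.
  apply: le_lt_trans (eb_mono eb (ltnW kn)) _.
  by rewrite /cutoff ltr_pdivlMr // exprn_gt0.
Qed.

Variable k : nat -> nat.
Hypothesis k0 : k 0%N = 0%N.
Hypothesis km : {homo k : m n / (m <= n)%N}.
Hypothesis klt : forall m i, (i < k m)%N -> `|l i| < cutoff m.
Hypothesis kle : forall m, cutoff m <= `|l (k m)|.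

Variables (b : bop) (M : R).
Hypothesis M0 : 0 <= M.
Hypothesis bdom : forall x, dom x -> dom (b x).
Hypothesis bM : forall x, dom x -> nrm (D (b x) - b (D x)) <= M * nrm x.
Hypothesis adom : forall x, dom x -> dom (badj b x).
Hypothesis aM : forall x, dom x ->
  nrm (D (badj b x) - badj b (D x)) <= M * nrm x.

Notation E m := (band (k m) (k m.+1)).
Notation G m := (band 0 (k m)).

(** The entries of b joining block N to blocks of index at most N - 2, in both directions. For N = 0
    the truncated predecessor is harmless: [k 0] is 0, so [G 0] is the zero projection. *)
Definition far N : bop :=
  badd (bcomp (E N) (bcomp b (G N.-1))) (bcomp (G N.-1) (bcomp b (E N))).

Fixpoint far_sum n : bop :=
  if n is m.+1 then badd (far_sum m) (far m) else bzero dot.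

Lemma far_sumS n x : far_sum n.+1 x = far_sum n x + far n x.
Proof. by rewrite -baddE. Qed.

(** The Sylvester bound between consecutive cuts is M q^N / (a (1 - q)). The further factor 1 - q
    lets it be written as a multiple of q^N - q^(N+1), which telescopes; the 2 counts the two halves
    of [far]. *)
Let c0 := 2 * (M / (a * (1 - q) ^+ 2)).

Let c0_ge0 : 0 <= c0.
Proof. by rewrite mulr_ge0 // divr_ge0 // mulr_ge0 ?(ltW a0) // sqr_ge0. Qed.

Lemma far_half (c : bop) N : (forall x, dom x -> dom (c x)) ->
  (forall x, dom x -> nrm (D (c x) - c (D x)) <= M * nrm x) ->
  bnd (bcomp (E N) (bcomp c (G N.-1))) (c0 / 2 * (q ^+ N - q ^+ N.+1)).
Proof.
move=> cdom cM.
have qN : 0 <= q ^+ N - q ^+ N.+1.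
  by rewrite subr_ge0 exprS ler_piMl ?exprn_ge0 ?ltW.
split=> [|x]; first by rewrite mulr_ge0 // divr_ge0.
rewrite !bcompE; case: N qN => [|N] qN.
  have -> : band 0 (k 0.-1) x = 0 by apply: band_empty; rewrite /= k0.
  rewrite !bop0 nrm0.
  by rewrite mulr_ge0 ?nrm_ge0 // mulr_ge0 // divr_ge0.
have h := sylvester dotH sD eb cdom cM M0 (ltW (cutoff_gt0 N)) (cutoff_lt N)
  (fun i ik => ltW (klt ik)) (kle N.+1) x.
have -> : E N.+1 (c (G N x)) = E N.+1 (c (G N x) - G N.+1 (c (G N x))).
  by rewrite bopB (@band_disjoint _ _ 0 (k N.+1)) ?subr0 // leqnn orbT.
rewrite (le_trans (nrm_band_le dotH eb _ _ _)) // (le_trans h) //.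
rewrite ler_wpM2r ?nrm_ge0 // le_eqVlt; apply/orP; left; apply/eqP.
have qn : q ^+ N != 0 by rewrite expf_neq0 // gt_eqF.
rewrite /c0 /cutoff !exprS; field.
have q1' : 1 - q != 0 by rewrite subr_eq0 gt_eqF.
have -> : a + - a * q = a * (1 - q) by ring.
have a0' : a != 0 by rewrite gt_eqF.
have q0' : q != 0 by rewrite gt_eqF.
by rewrite mulf_neq0 ?q1' ?a0' ?q0' ?qn.
Qed.

Lemma far_bound N x : nrm (far N x) <= c0 * (q ^+ N - q ^+ N.+1) * nrm x.
Proof.
have [_ /(_ x) h1] := far_half N bdom bM.
(* The second half of [far] is the adjoint of the first half formed with the adjoint of b. *)
have [_ /(_ x) h2] := bnd_adj dotH (far_half N adom aM).
rewrite /far baddE (le_trans (nrmD _ _)) //.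
apply: le_trans (lerD h1 h2) _; rewrite le_eqVlt; apply/orP; left; apply/eqP.
by field.
Qed.

Lemma far_sum_bound m n : (n <= m)%N ->
  bnd (bsub (far_sum m) (far_sum n)) (c0 * q ^+ n).
Proof.
move=> /subnK <-; set j := (m - n)%N; split=> [|x].
  by rewrite mulr_ge0 // exprn_ge0 // ltW.
rewrite bsubE.
have : nrm (far_sum (j + n) x - far_sum n x) <= c0 * (q ^+ n - q ^+ (j + n)) * nrm x.
  elim: j => [|j IH]; first by rewrite add0n !subrr nrm0 mulr0 mul0r.
  rewrite addSn far_sumS addrAC.
  rewrite (le_trans (nrmD _ _)) // (le_trans (lerD IH (far_bound _ _))) //.
  by rewrite le_eqVlt; apply/orP; left; apply/eqP; ring.
move=> /le_trans; apply; rewrite ler_wpM2r ?nrm_ge0 // ler_wpM2l //.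
by rewrite gerBl exprn_ge0 // ltW.
Qed.

Lemma E_far m N x : E m (far N x) =
  if m == N then E m (b (G m.-1 x))
  else if (m.+1 < N)%N then E m (b (E N x)) else 0.
Proof.
rewrite /far baddE !bcompE bopD.
case: (ltngtP m N) => [mN|Nm|<-].
- have -> : E m (E N (b (G N.-1 x))) = 0 by apply: band_disjoint; rewrite km.
  rewrite add0r; case: ltnP => mN2.
    by apply: band_sub => //; rewrite km // -ltnS prednK // (leq_trans _ mN2).
  by apply: band_disjoint; rewrite (@km N.-1 m) ?orbT // -ltnS prednK // (leq_trans _ mN).
- have -> : (m.+1 < N)%N = false.
    by apply/negbTE; rewrite -leqNgt (leq_trans (ltnW Nm)).
  have -> : E m (E N (b (G N.-1 x))) = 0 by apply: band_disjoint; rewrite (@km N.+1 m) ?orbT.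
  rewrite add0r; apply: band_disjoint.
  by rewrite (@km N.-1 m) ?orbT // (leq_trans (leq_pred _)) // ltnW.
- rewrite band_sub //.
  have -> : E m (G m.-1 (b (E m x))) = 0.
    by apply: band_disjoint; rewrite (@km m.-1 m) ?orbT // leq_pred.
  by rewrite addr0.
Qed.

Lemma E_far_sum_low m n x : (n <= m)%N -> E m (far_sum n x) = 0.
Proof.
elim: n => [|n IH] nm; first by rewrite (_ : far_sum 0 x = 0) // bop0.
rewrite far_sumS bopD IH ?(ltnW nm) // add0r E_far.
have -> : (m.+1 < n)%N = false by apply/negbTE; rewrite -leqNgt (leq_trans (ltnW nm)).
by rewrite gtn_eqF.
Qed.

(** In row m, the term N = m contributes all columns before block m - 1 at once, and the terms N >=
    m + 2 contribute one block each and telescope. In the limit only the columns of blocks m - 1, m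
    and m + 1 are missing. *)
Lemma E_far_sum m n x : E m (far_sum (n + m.+2) x) =
  E m (b (G m.-1 x)) + (E m (b (G (n + m.+2) x)) - E m (b (G m.+2 x))).
Proof.
elim: n => [|n IH].
  rewrite add0n subrr addr0 far_sumS bopD far_sumS bopD E_far_sum_low // add0r.
  by rewrite !E_far eqxx ltnn (ltn_eqF (ltnSn m)) addr0.
rewrite addSn far_sumS bopD IH E_far.
have mn : (m.+1 < n + m.+2)%N by rewrite leq_addl.
rewrite (ltn_eqF (ltnW mn)) mn -!addrA; congr (_ + _).
rewrite [RHS]addrC addrC -addrA; congr (_ + _).
rewrite -bopD; congr (E m _); rewrite -bopD; congr (b _).
rewrite (bandE dotH sD eb) ?km ?leqnSn //.
by rewrite subrK.
Qed.

(* The entries of [b] that join nonadjacent blocks add up, in norm, to an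
   operator [K] approximated by finite rank operators; [b - K] is tridiagonal. *)
Lemma tridiagonal_approx : (forall n, exists m, (n <= k m)%N) ->
  exists K : bop,
  (forall m x, E m (b x - K x) = E m (b (band (k m.-1) (k m.+2) x))) /\
  forall r, 0 < r -> exists n (T : bop), bnd (bsub K T) r /\
    forall x, band 0 n (T x) = T x /\ T (band 0 n x) = T x.
Proof.
move=> kinf.
have small := geometric_small q01 c0_ge0.
have [K KP] := bop_limit dotH small far_sum_bound.
exists K; split=> [m x|r /small[n /(_ n (leqnn n)) nr]]; last first.
  exists (k n), (far_sum n); split=> [|x].
    split=> [|x]; first by apply: ltW; apply: le_lt_trans nr; have [] := KP n.
    by have [_ /(_ x) h] := KP n; rewrite (le_trans h) // ler_wpM2r ?nrm_ge0 // ltW.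
  have : forall n', (n' <= n)%N -> band 0 (k n) (far_sum n' x) = far_sum n' x /\
      far_sum n' (band 0 (k n) x) = far_sum n' x.
    elim=> [_|n' IH n'n]; first by split; rewrite // bop0.
    have [h1 h2] := IH (ltnW n'n).
    have kn : (k n' <= k n)%N by rewrite km // ltnW.
    have kn1 : (k n'.+1 <= k n)%N by rewrite km.
    have kp : (k n'.-1 <= k n)%N by rewrite km // (leq_trans (leq_pred _)) // ltnW.
    rewrite !far_sumS bopD h1 h2 /far !baddE !bcompE bopD.
    have in_band c d y : (d <= k n)%N -> band 0 (k n) (band c d y) = band c d y.
      by move=> dn; rewrite band_band max0n (minn_idPr dn).
    have out_band c d y : (d <= k n)%N -> band c d (band 0 (k n) y) = band c d y.
      by move=> dn; rewrite band_sub.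
    by rewrite !in_band // !out_band.
  by apply.
have h1 : tends (fun n => E m (far_sum (n + m.+2) x)) (E m (K x)).
  apply: bop_tends => r r0.
  have x1 : 0 < nrm x + 1 by rewrite ltr_wpDl ?nrm_ge0.
  have [N Nr] := small _ (divr_gt0 r0 x1).
  exists N => n Nn; have := Nr _ (leq_trans Nn (leq_addr m.+2 n)).
  rewrite ltr_pdivlMr // nrmB; have [h0 /(_ x)] := KP (n + m.+2)%N; rewrite bsubE.
  have := nrm_ge0 x; nra.
have h2 : tends (fun n => E m (far_sum (n + m.+2) x))
    (E m (b (G m.-1 x)) + (E m (b x) - E m (b (G m.+2 x)))).
  have h3 : tends (fun n => E m (b (G (n + m.+2) x))) (E m (b x)).
    apply: bop_tends; apply: bop_tends => r r0.
    have [N Nr] := proj_tends dotH sD eb x r0; have [j Nj] := kinf N.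
    exists j => n jn; apply: Nr; apply: leq_trans Nj _; apply: km.
    exact: leq_trans jn (leq_addr _ _).
  have := tendsD (tends_cst (E m (b (G m.-1 x))))
    (tendsD h3 (tends_cst (- E m (b (G m.+2 x))))).
  by move=> h4 r /h4[N Nr]; exists N => n /Nr; rewrite E_far_sum.
have km2 : (k m.-1 <= k m.+2)%N by apply: km; rewrite (leq_trans (leq_pred m)) // ltnW.
rewrite (bandE dotH sD eb x km2) (bopB b) !(bopB (E m)) (tends_unique dotH h1 h2).
have alg (u v w : H) : u - (v + (u - w)) = w - v.
  by apply: (dot_inj (dot := dot)) => y; rewrite !(dotDl, dotNl); ring.
exact: alg.
Qed.

End Tridiagonal.

(** * Commutator of S with a tridiagonal operator *)

Section Commutator.
Context {R : realType} {H : completeNormedModType R[i]}.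
Variable dot : {dot H for (@conjC R[i])}.
Hypothesis dotH : hilbert dot.
Variables (dom : set H) (D : H -> H).
Hypothesis sD : self_adjoint dot dom D.
Variables (e : nat -> H) (l : nat -> R).
Hypothesis eb : eigenbasis dot dom D e l.
Notation bop := (bop dot).
Notation band := (band dotH e).

Variables (S : bop) (g : nat -> R).
Hypothesis g0 : forall j, 0 <= g j.
Hypothesis Sg : forall x j, dot (S x) (e j) = (g j)%:C * dot x (e j).

Lemma band_comm a b x : S (band a b x) = band a b (S x).
Proof.
apply: (eb_inj dotH sD eb) => j.
by rewrite Sg !(coef_diag dotH eb) Sg mulrCA.
Qed.

Lemma band_scalar a b x (s r : R) :
  (forall j, (a <= j)%N -> (j < b)%N -> `|g j - s| <= r) -> 0 <= r ->
  nrm (S (band a b x) - s%:C *: band a b x) <= r * nrm (band a b x).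
Proof.
move=> gs r0.
have -> : S (band a b x) - s%:C *: band a b x =
    bdiag dotH e (fun j => (a <= j)%N%:R * (g j - s)) b x.
  apply: (eb_inj dotH sD eb) => j.
  rewrite dotBl dotZl Sg !(coef_diag dotH eb) -mulrBl -rmorphB mulrA -realcM.
  congr (_%:C * _).
  by case: ifP => _; rewrite ?mulr0 // mulrC.
rewrite -(ger0_norm r0) -nrmZR -(diag_scale dotH); apply: (nrm_diag_le dotH eb) => j jb.
case: leqP => aj; last by rewrite mul0r mulr0 normr0.
by rewrite mul1r mulr1 (ger0_norm r0) gs.
Qed.

Lemma band_lower a b x (s c : R) : 0 <= s -> 0 <= c ->
  (forall j, (a <= j)%N -> (j < b)%N -> s <= c * g j) ->
  s * nrm (band a b x) <= c * nrm (S (band a b x)).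
Proof.
move=> s0 c0 gs.
have -> : S (band a b x) = bdiag dotH e (fun j => g j * (a <= j)%N%:R) b x.
  apply: (eb_inj dotH sD eb) => j; rewrite Sg !(coef_diag dotH eb) mulrA -realcM.
  by congr (_%:C * _); case: ltnP; rewrite ?mulr0.
rewrite -(ger0_norm s0) -(ger0_norm c0) -!nrmZR -!(diag_scale dotH).
apply: (nrm_diag_le dotH eb) => j jb.
case: leqP => aj; last by rewrite !mulr0 normr0.
by rewrite !mulr1 !ger0_norm ?mulr_ge0 // gs.
Qed.

Lemma sum_blocks (j : nat -> nat) (f : nat -> R) n : {homo j : m n / (m <= n)%N} ->
  \sum_(0 <= m < n) \sum_(j m <= i < j m.+1) f i = \sum_(j 0%N <= i < j n) f i.
Proof.
move=> jm; elim: n => [|n IH]; first by rewrite !big_geq.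
by rewrite big_nat_recr //= IH -big_cat_nat //; exact: jm.
Qed.

Variable k : nat -> nat.
Hypothesis k0 : k 0%N = 0%N.
Hypothesis km : {homo k : m n / (m <= n)%N}.
Hypothesis kinf : forall n, exists m, (n <= k m)%N.

Notation E m := (band (k m) (k m.+1)).
Notation F m := (band (k m.-1) (k m.+2)).

Variables (s : nat -> R) (r : R).
Hypothesis s0 : forall m, 0 <= s m.
Hypothesis r0 : 0 <= r.
(** On a block and its two neighbours S is nearly the scalar [s m]; the second inequality converts
    the error r s_m |F x| into a multiple of |S F x|. *)
Hypothesis gs : forall m j, (k m.-1 <= j)%N -> (j < k m.+2)%N ->
  `|g j - s m| <= r * s m /\ s m <= 4 * g j.

Variables (b T : bop) (beta : R).
Hypothesis bb : bnd b beta.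
Hypothesis ET : forall m x, E m (T x) = E m (b (F m x)).

Definition comm X Y : bop := bsub (bcomp X Y) (bcomp Y X).

Lemma commE X Y x : comm X Y x = X (Y x) - Y (X x).
Proof. by rewrite bsubE. Qed.

(* On adjacent blocks [S] is a scalar up to a relative error [r], which bounds the
   commutator of [S] with the tridiagonal [T] relatively to [S]. *)
Lemma block_comm m x : nrm (E m (comm S T x)) <= 8 * r * beta * nrm (F m (S x)).
Proof.
pose z := b (F m x).
have [b0 bx] := bb.
have mE j : (k m <= j)%N -> (j < k m.+1)%N -> `|g j - s m| <= r * s m.
  move=> h1 h2; apply: (gs (m := m) _ _).1.
    by apply: leq_trans h1; apply: km; exact: leq_pred.
  by apply: leq_trans h2 _; apply: km.
have mF j : (k m.-1 <= j)%N -> (j < k m.+2)%N -> `|g j - s m| <= r * s m.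
  by move=> h1 h2; have [] := gs h1 h2.
have mF' j : (k m.-1 <= j)%N -> (j < k m.+2)%N -> s m <= 4 * g j.
  by move=> h1 h2; have [] := gs h1 h2.
have rs : 0 <= r * s m by rewrite mulr_ge0.
(* Subtracting the scalar [s m] from S does not change the commutator. Each of the two terms is then
   at most r s_m beta |F x|, and s_m |F x| <= 4 |S F x| explains the constant 8. *)
have -> : E m (comm S T x) =
    (S (E m z) - (s m)%:C *: E m z) - E m (b (S (F m x) - (s m)%:C *: F m x)).
  rewrite commE (bopB (E m)) -band_comm !ET -band_comm.
  rewrite (bopB b) (bopB (E m)) (bopZ b) (bopZ (E m)) -/z.
  have alg (u v w : H) : u - v = u - w - (v - w).
    by apply: (dot_inj (dot := dot)) => y; rewrite !(dotDl, dotNl); ring.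
  exact: alg.
have h1 := band_scalar z mE rs.
have h2 := band_scalar x mF rs.
have h3 := band_lower x (s0 m) (ler0n _ 4) mF'.
have h4 := nrm_band_le dotH eb (k m) (k m.+1) z.
have h5 : nrm z <= beta * nrm (F m x) by exact: bx.
have h6 := nrm_band_le dotH eb (k m) (k m.+1) (b (S (F m x) - (s m)%:C *: F m x)).
have h7 := bx (S (F m x) - (s m)%:C *: F m x).
have h8 : nrm (S (E m z) - (s m)%:C *: E m z) <= r * s m * (beta * nrm (F m x)).
  by rewrite (le_trans h1) // ler_wpM2l // (le_trans h4).
have h9 : nrm (E m (b (S (F m x) - (s m)%:C *: F m x))) <=
    beta * (r * s m * nrm (F m x)).
  by rewrite (le_trans h6) // (le_trans h7) // ler_wpM2l.
rewrite (le_trans (nrmD _ _)) // nrmN (le_trans (lerD h8 h9)) //.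
rewrite -(band_comm (k m.-1)).
have h10 := ler_wpM2l (mulr_ge0 r0 b0) h3; lra.
Qed.

(** The block estimates are squared and summed; the windows [F m] overlap so that each index lies in
    at most three of them, hence the factor 3. *)
Lemma comm_bound x : nrm (comm S T x) ^+ 2 <=
  3 * (8 * r * beta) ^+ 2 * nrm (S x) ^+ 2.
Proof.
have [b0 _] := bb.
set c := 8 * r * beta.
have c0 : 0 <= c by rewrite !mulr_ge0.
apply: (nrm_le_coef2 dotH sD eb kinf) => n.
rewrite -{1}k0 -(sum_blocks (coef2 dot e _) n km).
pose f i := coef2 dot e (S x) i.
have f0 i : 0 <= f i by exact: coef2_ge0.
apply: (@le_trans _ _ (\sum_(0 <= m < n) c ^+ 2 * \sum_(k m.-1 <= i < k m.+2) f i)).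
  apply: ler_sum => m _.
  rewrite -(nrm_band dotH eb) ?km // -(nrm_band dotH eb); last first.
    by apply: km; rewrite (leq_trans (leq_pred m)) // ltnW.
  rewrite -exprMn ler_sqr ?nnegrE ?mulr_ge0 ?nrm_ge0 //; exact: block_comm.
have -> : 3 * c ^+ 2 * nrm (S x) ^+ 2 = c ^+ 2 * (3 * nrm (S x) ^+ 2) by ring.
rewrite -mulr_sumr ler_wpM2l ?sqr_ge0 //.
have split m : \sum_(k m.-1 <= i < k m.+2) f i =
    \sum_(k m.-1 <= i < k m) f i + \sum_(k m <= i < k m.+1) f i +
    \sum_(k m.+1 <= i < k m.+2) f i.
  rewrite -big_cat_nat ?km ?leq_pred //= -big_cat_nat ?km //.
  by rewrite (leq_trans (leq_pred m)).
rewrite (eq_bigr _ (fun m _ => split m)) !big_split /=.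
have total i j : \sum_(i <= m < j) f m <= nrm (S x) ^+ 2.
  apply: le_trans (sum_coef2_le dotH eb (S x) (maxn i j)).
  rewrite (big_cat_nat (leq0n i) (leq_maxl i j)) /= -[leLHS]add0r lerD //.
    by rewrite sumr_ge0.
  case: (leqP i j) => ij; first by rewrite ?(maxn_idPr ij) // lexx.
  by rewrite !big_geq // ?geq_max ?leqnn ltnW.
rewrite (sum_blocks f n km).
rewrite (@sum_blocks (fun m => k m.-1) f n) => [|m1 m2 h]; last first.
  by apply: km; case: m1 m2 h => [|m1] [|m2].
rewrite (@sum_blocks (fun m => k m.+1) f n) => [|m1 m2 h]; last exact: km.
have := total (k 0.-1) (k n.-1); have := total (k 0%N) (k n).
have := total (k 1%N) (k n.+1); rewrite /=; lra.
Qed.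

End Commutator.

(** * Vanishing of N([S, b]) *)

Section CommutatorNull.
Context {R : realType} {H : completeNormedModType R[i]}.
Variable dot : {dot H for (@conjC R[i])}.
Hypothesis dotH : hilbert dot.
Variable tau : (H -> H) -> \bar R.
Hypothesis tauW : tracial_weight dot tau.
Notation bop := (bop dot).
Implicit Types X Y Z : bop.

Lemma sqw_le_real X (c : R) : (sqw tau X <= c%:E)%E -> rsqw tau X <= c.
Proof.
move=> h; have fX : finw tau X by rewrite /finw (le_lt_trans h) // ltry.
by move: h; rewrite (rsqwE dotH tauW fX) lee_fin.
Qed.

Lemma rsqw_le2 (a b : R) X Y Z : 0 <= a -> 0 <= b -> finw tau X -> finw tau Y ->
  (forall x, nrm (Z x) ^+ 2 <= a * nrm (X x) ^+ 2 + b * nrm (Y x) ^+ 2) ->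
  rsqw tau Z <= a * rsqw tau X + b * rsqw tau Y.
Proof.
move=> a0 b0 fX fY le; apply: sqw_le_real.
have := sqw_le2 dotH tauW a0 b0 le.
by rewrite (rsqwE dotH tauW fX) (rsqwE dotH tauW fY) -!EFinM -EFinD.
Qed.

Lemma rsqw_le (a : R) X Z : 0 <= a -> finw tau X ->
  (forall x, nrm (Z x) ^+ 2 <= a * nrm (X x) ^+ 2) -> rsqw tau Z <= a * rsqw tau X.
Proof.
move=> a0 fX le; apply: sqw_le_real; have := sqw_le dotH tauW a0 le.
by rewrite (rsqwE dotH tauW fX) -EFinM.
Qed.

Lemma rsqw_sum X Y Z : finw tau X -> finw tau Y -> (forall x, Z x = X x + Y x) ->
  rsqw tau Z <= 2 * rsqw tau X + 2 * rsqw tau Y.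
Proof.
move=> fX fY ZE; apply: rsqw_le2 => // x; rewrite ZE.
have := parallelogram dotH (X x) (Y x); have := sqr_ge0 (nrm (X x - Y x)); lra.
Qed.

Lemma rsqw_compl X Z c : finw tau X -> bnd Z c ->
  rsqw tau (bcomp Z X) <= c ^+ 2 * rsqw tau X.
Proof.
move=> fX Zc; apply: sqw_le_real; have := sqw_compl dotH tauW X Zc.
by rewrite (rsqwE dotH tauW fX) -EFinM.
Qed.

Lemma rsqw_compr X Z c : finw tau X -> bnd Z c ->
  rsqw tau (bcomp X Z) <= c ^+ 2 * rsqw tau X.
Proof.
move=> fX Zc; apply: sqw_le_real; have := sqw_compr dotH tauW X Zc.
by rewrite (rsqwE dotH tauW fX) -EFinM.
Qed.

Lemma rsqw_comm_le X Z c : finw tau X -> bnd Z c ->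
  rsqw tau (comm X Z) <= 4 * c ^+ 2 * rsqw tau X.
Proof.
move=> fX Zc.
have h : rsqw tau (comm X Z) <= 2 * rsqw tau (bcomp X Z) + 2 * rsqw tau (bcomp Z X).
  apply: rsqw_le2 => // [||x];
    [exact: (finw_compr dotH tauW)|exact: (finw_compl dotH tauW)|].
  rewrite commE.
  have := parallelogram dotH (X (Z x)) (Z (X x)).
  have := sqr_ge0 (nrm (X (Z x) + Z (X x))); rewrite !bcompE; lra.
have := rsqw_compl fX Zc; have := rsqw_compr fX Zc; lra.
Qed.

Lemma ge0_eq0_of_small (x c : R) : 0 <= x ->
  (forall r, 0 < r -> r <= 2^-1 -> x <= c * r) -> x = 0.
Proof.
move=> x0 le; apply/eqP; rewrite eq_le x0 andbT leNgt; apply/negP => xp.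
have h2 : 0 < 2^-1 :> R by rewrite invr_gt0.
have c0 : 0 < c by have := le _ h2 (lexx _); lra.
(* This value is at most 1/2, and c times it is less than x. *)
have r0 : 0 < x / (2 * c + 2 * x) by rewrite divr_gt0 //; lra.
have := le _ r0; rewrite ler_pdivrMr; last by lra.
have -> : x <= 2^-1 * (2 * c + 2 * x) by lra.
move=> /(_ isT); rewrite mulrA ler_pdivlMr; last by lra.
nra.
Qed.

Variables (dom : set H) (D : H -> H).
Hypothesis sD : self_adjoint dot dom D.
Variables (e : nat -> H) (l : nat -> R).
Hypothesis eb : eigenbasis dot dom D e l.
Hypothesis tau0 : forall P, projection dot P -> finite_rank P -> tau P = 0%E.

Lemma finw_band n : finw tau (band dotH e 0 n) /\ rsqw tau (band dotH e 0 n) = 0.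
Proof.
suff E : sqw tau (band dotH e 0 n) = 0%E by rewrite /finw /rsqw E.
have PP x : band dotH e 0 n (band dotH e 0 n x) = band dotH e 0 n x.
  exact: (band_sub dotH sD eb).
rewrite /sqw; have -> : badjfun (band dotH e 0 n) \o band dotH e 0 n = band dotH e 0 n.
  by apply/funext => x; exact: PP.
apply: tau0.
  by split=> //; [exact: bfun_bounded|exact: (bopP (band dotH e 0 n))].
exists n, e => x; exists (fun i => 1%:C * dot x (e i)).
by [].
Qed.

Variable p : R.
Hypothesis p0 : 0 < p.

Lemma powRN_anti (x y : R) : 0 < x -> x <= y -> y `^ (- p) <= x `^ (- p).
Proof.
move=> x0 xy; have y0 : 0 < y by exact: lt_le_trans xy.
rewrite !powRN lef_pV2 ?posrE ?powR_gt0 //.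
by apply: ge0_ler_powR => //; rewrite ?nnegrE ltW.
Qed.

Definition eigpow j : R := `|l j| `^ (- p).

Lemma eigpow_ge0 j : 0 <= eigpow j. Proof. exact: powR_ge0. Qed.

Lemma eigpow_anti : {homo eigpow : m n / (m <= n)%N >-> n <= m}.
Proof.
move=> m n mn; apply: powRN_anti; first exact: (eb_absl_gt0 eb).
exact: (eb_mono eb).
Qed.

Lemma eigpow_small r : 0 < r -> exists n, eigpow n < r.
Proof.
(* The inequality |l n|^-p < r means |l n| > r^(-1/p); adding 1 makes it strict. *)
move=> r0; have [n nC] := eb_unbounded eb (r `^ (- p^-1) + 1); exists n.
have c0 : 0 < r `^ (- p^-1) by rewrite powR_gt0.
rewrite /eigpow powRN invf_plt ?posrE ?powR_gt0 ?(eb_absl_gt0 eb) //.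
have -> : r^-1 = (r `^ (- p^-1)) `^ p.
  by rewrite -powRrM mulNr mulVf ?gt_eqF // powR_inv1 // ltW.
by apply: gt0_ltr_powR; rewrite ?nnegrE ?ltW //; lra.
Qed.

Lemma eigpow_op : exists S : bop,
  forall x j, dot (S x) (e j) = (eigpow j)%:C * dot x (e j).
Proof.
exact: (diag_limit dotH sD eb eigpow_ge0 eigpow_anti eigpow_small).
Qed.

Variable S : bop.
Hypothesis Sg : forall x j, dot (S x) (e j) = (eigpow j)%:C * dot x (e j).
Hypothesis fS : finw tau S.

Variables (b : bop) (M : R).
Hypothesis M0 : 0 <= M.
Hypothesis bdom : forall x, dom x -> dom (b x).
Hypothesis bM : forall x, dom x -> nrm (D (b x) - b (D x)) <= M * nrm x.
Hypothesis adom : forall x, dom x -> dom (badj b x).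
Hypothesis aM : forall x, dom x ->
  nrm (D (badj b x) - badj b (D x)) <= M * nrm x.

(* A singular trace kills finite rank operators, so only the small remainder of
   [K] contributes. *)
Lemma compact_comm_null (K : bop) :
  (forall r, 0 < r -> exists n (T : bop), bnd (bsub K T) r /\
    forall x, band dotH e 0 n (T x) = T x /\ T (band dotH e 0 n x) = T x) ->
  rsqw tau (comm S K) = 0.
Proof.
move=> Kap; apply: (@ge0_eq0_of_small _ (8 * rsqw tau S)); first exact: rsqw_ge0.
move=> r r0 r2; have [n [T [KT TP]]] := Kap _ r0.
have [fP P0] := finw_band n.
have [c ST] := bounded_bnd (bounded_comp (bfun_bounded S) (bfun_bounded T)).
have [d TS] := bounded_bnd (bounded_comp (bfun_bounded T) (bfun_bounded S)).
have fK Z : finw tau (comm S Z).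
  apply: (finw_lin dotH tauW);
    [exact: (finw_compl dotH tauW)|exact: (finw_compr dotH tauW)].
have h1 := rsqw_sum (Z := comm S K) (fK T) (fK (bsub K T)).
have h2 := rsqw_comm_le fS KT.
(* With P the projection of [finw_band], S T = (S T) P and T S = P (T S), so both inherit N(P) =
   0. *)
have h3 : rsqw tau (bcomp S T) = 0.
  apply/eqP; rewrite eq_le rsqw_ge0 // andbT.
  have := rsqw_compl (Z := bcomp S T) fP ST.
  rewrite P0 mulr0; apply: le_trans; rewrite le_eqVlt; apply/orP; left; apply/eqP.
  by apply: (rsqw_eq dotH tauW) => x; rewrite !bcompE (TP x).2.
have h4 : rsqw tau (bcomp T S) = 0.
  apply/eqP; rewrite eq_le rsqw_ge0 // andbT.
  have := rsqw_compr (Z := bcomp T S) fP TS.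
  rewrite P0 mulr0; apply: le_trans; rewrite le_eqVlt; apply/orP; left; apply/eqP.
  by apply: (rsqw_eq dotH tauW) => x; rewrite !bcompE (TP _).1.
have h5 : rsqw tau (comm S T) <= 2 * rsqw tau (bcomp S T) + 2 * rsqw tau (bcomp T S).
  apply: rsqw_le2 => // [||x];
    [exact: (finw_compr dotH tauW)|exact: (finw_compl dotH tauW)|].
  rewrite commE.
  have := parallelogram dotH (S (T x)) (T (S x)).
  have := sqr_ge0 (nrm (S (T x) + T (S x))); rewrite !bcompE; lra.
have h6 : rsqw tau (comm S K) <= 2 * rsqw tau (comm S T) + 2 * rsqw tau (comm S (bsub K T)).
  apply: h1 => x; rewrite !commE !bsubE (bopB S).
  have alg (u v w z : H) : u - v = w - z + (u - w - (v - z)).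
    by apply: (dot_inj (dot := dot)) => y; rewrite !(dotDl, dotNl); ring.
  exact: alg.
have s0 : 0 <= rsqw tau S by exact: rsqw_ge0.
have h7 : r ^+ 2 * rsqw tau S <= r * rsqw tau S.
  by rewrite ler_wpM2r // expr2 ler_piMl ?ltW //; lra.
rewrite h3 h4 in h5; lra.
Qed.

Lemma commutator_null : rsqw tau (comm S b) = 0.
Proof.
have [beta bb] := bounded_bnd (bfun_bounded b).
(* 1536 = 2 * 3 * (8 * 2)^2: a factor 2 for splitting off [K], and [comm_bound] with relative error
   2 r. *)
apply: (@ge0_eq0_of_small _ (1536 * beta ^+ 2 * rsqw tau S)).
  exact: rsqw_ge0.
move=> r r0 r2.
(* The cuts have ratio [q] with q^p = w, so that the values [s] of |D|^-p at consecutive cuts have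
   ratio exactly 1 - r. *)
pose w : R := 1 - r; have w0 : 0 < w by rewrite /w; lra.
pose q := w `^ p^-1.
have w1 : w < 1 by rewrite /w; lra.
have q01 : 0 < q < 1.
  rewrite powR_gt0 //= (_ : 1 = 1 `^ p^-1); last by rewrite powR1.
  by apply: gt0_ltr_powR; rewrite ?nnegrE ?invr_gt0 // ltW.
pose a : R := `|l 0%N|.
have [k [k0 km klt kle kinf]] := blocks_exist eb (erefl a) q01.
have [K [KT Kap]] := tridiagonal_approx dotH sD eb (erefl a) q01 k0 km klt kle M0
  bdom bM adom aM kinf.
have R0 m : 0 < cutoff a q m by exact: (cutoff_gt0 eb (erefl a) q01).
pose s m := cutoff a q m `^ (- p).
have sS m : s m.+1 = w * s m.
  rewrite /s (cutoffS a q01 m) powRM ?(ltW (R0 _)) //; last by case/andP: q01 => /ltW.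
  have -> : q `^ (- p) = w^-1.
    by rewrite /q -powRrM mulrN mulVf ?gt_eqF // powR_inv1 // ltW.
  by rewrite mulrA divff ?mul1r // gt_eqF.
have s0 m : 0 <= s m by exact: powR_ge0.
(* On the window, w^2 s_m <= [eigpow j] <= s_m / w. As w = 1 - r is at least 1/2, this gives the
   relative error 2 r and the factor 4. *)
have gs m j : (k m.-1 <= j)%N -> (j < k m.+2)%N ->
    `|eigpow j - s m| <= 2 * r * s m /\ s m <= 4 * eigpow j.
  move=> kj jk.
  have h1 : w * eigpow j <= s m.
    have h : eigpow j <= s m.-1.
      apply: powRN_anti => //; apply: le_trans (kle _) _; exact: (eb_mono eb).
    case: m {jk kj} h => [|m] /= h.
      by rewrite (le_trans _ h) // ler_piMl ?eigpow_ge0 // ltW.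
    by rewrite sS ler_wpM2l // ltW.
  have h2 : w * (w * s m) <= eigpow j.
    rewrite -!sS; apply: powRN_anti; first exact: (eb_absl_gt0 eb).
    by apply: ltW; exact: klt.
  have sm := s0 m; have gj := eigpow_ge0 j.
  have w2 : 2^-1 <= w by rewrite /w; lra.
  have gs2 : eigpow j <= 2 * s m by nra.
  have h3 : r * eigpow j <= r * (2 * s m) by rewrite ler_wpM2l // ltW.
  have h4 : 2^-1 * (2^-1 * s m) <= w * (w * s m).
    by rewrite !mulrA ler_wpM2r // ler_pM.
  have h5 : 0 <= r * (r * s m) by rewrite !mulr_ge0 // ltW.
  split; last by lra.
  by rewrite ler_norml; apply/andP; split; rewrite /w in h1 h2; lra.
have r2' : 0 <= 2 * r by lra.
have ET m x : band dotH e (k m) (k m.+1) (bsub b K x) =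
    band dotH e (k m) (k m.+1) (b (band dotH e (k m.-1) (k m.+2) x)).
  by rewrite bsubE KT.
have h1 := comm_bound sD eb eigpow_ge0 Sg k0 km kinf s0 r2' gs bb ET.
have h2 := compact_comm_null Kap.
have fC Z : finw tau (comm S Z).
  apply: (finw_lin dotH tauW);
    [exact: (finw_compl dotH tauW)|exact: (finw_compr dotH tauW)].
have h3 : rsqw tau (comm S b) <=
    2 * rsqw tau (comm S (bsub b K)) + 2 * rsqw tau (comm S K).
  apply: rsqw_sum => // x; rewrite !commE !bsubE (bopB S).
  have alg (u v w' z : H) : u - v = u - w' - (v - z) + (w' - z).
    by apply: (dot_inj (dot := dot)) => y; rewrite !(dotDl, dotNl); ring.
  exact: alg.
have h4 := rsqw_le (mulr_ge0 (ler0n _ 3) (sqr_ge0 (8 * (2 * r) * beta))) fS h1.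
have S0 : 0 <= rsqw tau S by exact: (rsqw_ge0 dotH tauW).
have h5 : r ^+ 2 * (beta ^+ 2 * rsqw tau S) <= r * (beta ^+ 2 * rsqw tau S).
  apply: ler_wpM2r; first by rewrite mulr_ge0 ?sqr_ge0.
  by rewrite expr2 ler_piMl ?(ltW r0) //; lra.
rewrite h2 in h3; lra.
Qed.

End CommutatorNull.

(** * The Hausdorff-Besicovitch functional *)

Section FunctionalCalculus.
Context {R : realType} {H : completeNormedModType R[i]}.
Variable dot : {dot H for (@conjC R[i])}.
Hypothesis dotH : hilbert dot.
Variables (dom : set H) (D : H -> H).
Hypothesis sD : self_adjoint dot dom D.
Variables (e : nat -> H) (l : nat -> R).
Hypothesis eb : eigenbasis dot dom D e l.
Notation bop := (bop dot).

Lemma bounded_eq_basis (V W : H -> H) : bounded_op V -> bounded_op W ->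
  (forall j, V (e j) = W (e j)) -> V = W.
Proof.
move=> bV bW VW; apply/funext => x.
have sum (U : H -> H) n : bounded_op U ->
    U (diag dot e (fun=> 1) n x) = \sum_(i < n) (1%:C * dot x (e i)) *: U (e i).
  move=> [lU _].
  rewrite (big_morph U (id1 := 0) (op1 := +%R)) => [|u v|]; last exact: linear_map0.
    by apply: eq_bigr => i _; exact: linear_mapZ.
  by have := lU 1 u v; rewrite !scale1r.
apply: (tends_unique dotH (tends_bounded bV (proj_tends dotH sD eb x))).
have hW := tends_bounded bW (proj_tends dotH sD eb x).
move=> r /hW[N Nr]; exists N => n /Nr.
rewrite !sum // (eq_bigr (fun i : 'I_n => (1%:C * dot x (e i)) *: V (e i))) // => i _.
by rewrite VW.
Qed.

Variables (p : R) (S : bop).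
Hypothesis Sg : forall x j, dot (S x) (e j) = (eigpow l p j)%:C * dot x (e j).

Let h j : R := `|l j| `^ (- (p + p)).

Let h0 j : 0 <= h j. Proof. exact: powR_ge0. Qed.

Lemma coef_square x j : dot (bcomp S S x) (e j) = (h j)%:C * dot x (e j).
Proof.
rewrite bcompE !Sg mulrA -realcM; congr (_%:C * _).
by rewrite /eigpow /h opprD powRD // (gt_eqF (eb_absl_gt0 eb j)) implybT.
Qed.

(** S^2 meets the specification behind the [xget], and any bounded operator meeting it is determined
    by its values on the basis. *)
Lemma abs_inv_powE : abs_inv_pow dom D (p + p) = bcomp S S.
Proof.
rewrite /abs_inv_pow /fun_calc; set P := (X in xget _ X).
have PS : P (bcomp S S).
  split=> [|c x dx Dx]; first exact: bfun_bounded.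
  apply: (eb_inj dotH sD eb) => j; rewrite coef_square dotZl.
  by have [->|->] := eb_eigenvector sD eb j dx Dx; rewrite ?mulr0.
have [bW PW] : P (xget (fun=> 0) P) by apply: xgetPex; exists (bfun (bcomp S S)).
apply: bounded_eq_basis => // [|j]; first exact: bfun_bounded.
by rewrite (PW _ _ (eb_dom eb j) (eb_eigen eb j)) (basis_eigen dotH sD eb _ coef_square).
Qed.

(** Nontriviality of tau is stated for the absolute value of |D|^-s; this identifies it with |D|^-s
    itself. *)
Lemma abs_op_square : abs_op dot (bcomp S S) = bcomp S S.
Proof.
rewrite /abs_op /abs_pow /fun_calc adjointE //; set P := (X in xget _ X).
have aS x : badjfun (bcomp S S) x = bcomp S S x by exact: (coef_adj dotH sD eb coef_square).
have sq2 j : ((h j) ^+ 2) `^ (1 / 2) = h j.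
  by rewrite mul1r powR12_sqrt ?sqr_ge0 // sqrtr_sqr ger0_norm.
have hh x j : dot (badjfun (bcomp S S) (bcomp S S x)) (e j) = (h j ^+ 2)%:C * dot x (e j).
  by rewrite aS !coef_square mulrA -realcM.
have PS : P (bcomp S S).
  split=> [|c x _ Tx]; first exact: bfun_bounded.
  apply: (eb_inj dotH sD eb) => j; rewrite coef_square dotZl.
  have := hh x j; rewrite [X in dot X]Tx dotZl => /eqP.
  rewrite -subr_eq0 -mulrBl mulf_eq0 -rmorphB => /orP[|/eqP->]; last by rewrite !mulr0.
  rewrite -[0]/(0%:C) (inj_eq (@complexI R)) subr_eq0 => /eqP ->.
  by rewrite sq2.
have [bW PW] : P (xget (fun=> 0) P) by apply: xgetPex; exists (bfun (bcomp S S)).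
apply: bounded_eq_basis => // [|j]; first exact: bfun_bounded.
rewrite (basis_eigen dotH sD eb _ coef_square) -[in RHS]sq2; apply: PW => //.
pose T := bcomp S S.
by apply: (eb_inj dotH sD eb) => i; rewrite hh -(basis_eigen dotH sD eb j (X := bcomp (badj T) T) hh) bcompE hh.
Qed.

End FunctionalCalculus.

(** * Trace property of X |-> tau(X S^2) *)

Section HypertraceProperty.
Context {R : realType} {H : completeNormedModType R[i]}.
Variable dot : {dot H for (@conjC R[i])}.
Hypothesis dotH : hilbert dot.
Variable tau : (H -> H) -> \bar R.
Hypothesis tauW : tracial_weight dot tau.
Notation bop := (bop dot).
Variable S : bop.
Hypothesis Sa : forall x, badjfun S x = S x.
Hypothesis fS : finw tau S.

Lemma weight_value_right (a : H -> H) (X : bop) : (forall x, a x = X x) ->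
  weight_value dot tau (a \o (S \o S)) (ip tau (bcomp X S) S).
Proof.
move=> aX; have -> : a \o (S \o S) = bcomp X S \o badjfun S.
  by apply/funext => x /=; rewrite aX Sa.
by apply: (weight_value_ipC dotH tauW) => //; exact: (finw_compl dotH tauW).
Qed.

(* The functional [X |-> tau (X S^2)] commutes with b as soon as the commutator
   of S and b vanishes in the Hilbert-Schmidt seminorm of [tau]. *)
Lemma ip_commute (a b : bop) : rsqw tau (comm S b) = 0 ->
  ip tau (bcomp (bcomp a b) S) S = ip tau (bcomp (bcomp b a) S) S.
Proof.
move=> C0.
have fl Z : finw tau (bcomp Z S) by exact: (finw_compl dotH tauW).
have fr Z : finw tau (bcomp S Z) by exact: (finw_compr dotH tauW).
have fC : finw tau (comm S b) by exact: (finw_lin dotH tauW).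
(* The chain is tau(S a b S) = tau(S a S b) = tau(a S b S) = tau(a S S b) = tau(S b a S). The first
   and third equalities drop a pairing with [S, b]; the other two are the trace property. *)
pose v := ip tau (bcomp a (bcomp S b)) S.
have fv : finw tau (bcomp a (bcomp S b)) by exact: (finw_compl dotH tauW).
have v1 := weight_value_ip dotH tauW fv fS.
have v2 := weight_value_ipC dotH tauW fv fS.
transitivity v.
  have h1 := weight_value_ip dotH tauW (fl (bcomp a b)) fS.
  have h2 := weight_value_ip dotH tauW fC (fl (badj a)).
  have h3 : ip tau (comm S b) (bcomp (badj a) S) = 0.
    rewrite (ip_conj dotH tauW) (ip_null dotH tauW (fl (badj a)) fC C0).
    exact: conjc0.
  have := weight_value_lin tauW 1 h1 h2; rewrite h3 mul1r addr0 => h4.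
  apply: (weight_value_unique tauW h4).
  have -> // : 1 *: (badjfun S \o bcomp (bcomp a b) S) +
      (badjfun (bcomp (badj a) S) \o comm S b) =
      badjfun S \o bcomp a (bcomp S b).
  apply/funext => x; rewrite add_funE scale_funE !comp_funE scale1r commE /= !Sa.
  by rewrite (bopB a) (bopB S) addrCA subrr addr0.
have h1 := weight_value_ip dotH tauW (fl (bcomp b a)) fS.
have h2 := weight_value_ipC dotH tauW (fl a) (finw_adj tauW fC).
have h3 : ip tau (bcomp a S) (badj (comm S b)) = 0.
  by apply: (ip_null dotH tauW) => //; [exact: (finw_adj tauW)|rewrite rsqw_adj].
symmetry.
have g1 := weight_value_ip dotH tauW (fl a) (finw_adj tauW (fr b)).
have g2 := weight_value_ipC dotH tauW (fl a) (finw_adj tauW (fr b)).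
have e1 : badjfun (badj (bcomp S b)) \o bcomp a S = badjfun S \o bcomp (bcomp b a) S.
  by apply/funext => x /=; rewrite Sa.
rewrite e1 in g1; rewrite (weight_value_unique tauW h1 g1).
have := weight_value_lin tauW (-1) h2 g2; rewrite h3 mulr0 add0r => h4.
apply: (weight_value_unique tauW h4).
have -> // : -1 *: (bcomp a S \o badjfun (badj (comm S b))) +
    (bcomp a S \o badjfun (badj (bcomp S b))) = bcomp a (bcomp S b) \o badjfun S.
apply/funext => x; rewrite add_funE scale_funE !comp_funE scaleN1r.
have cE : badjfun (badj (comm S b)) x = S (b x) - b (S x) by rewrite -commE.
have sE : badjfun (badj (bcomp S b)) x = S (b x) by [].
rewrite cE sE !bcompE Sa (bopB S) (bopB a) opprB subrK //.
Qed.

End HypertraceProperty.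

Theorem theorem2p4 (R : realType)
    (A : lmodType R[i]) (mul : A -> A -> A) (star : A -> A)
    (H : completeNormedModType R[i]) (dot : {dot H for (@conjC R[i])})
    (act : A -> H -> H) (dom : set H) (D : H -> H)
    (hD : spectral_triple mul star dot act dom D)
    (hD0 : zero_not_eigenvalue dom D)
    (s : R) (hs : singular_exponent dot s (abs_inv_pow dom D 1))
    (tau : (H -> H) -> \bar R) (htau : singular_trace dot tau)
    (hnt : nontrivial_on dot tau (abs_inv_pow dom D s)) :
  (forall a, weight_domain dot tau (act a \o abs_inv_pow dom D s)) /\
  trace_state mul star act
    (fun a => trace_of dot tau (act a \o abs_inv_pow dom D s)
              / (fine (tau (abs_inv_pow dom D s)))%:C).
Proof.
have [s0 _] := hs; have [tauW _ tau0] := htau.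
have [_ dotH [actB actL actM actA] sD cD dC] := hD.
have [e [l eb]] := eigenbasisP dotH sD cD hD0.
have p0 : 0 < s / 2 by rewrite divr_gt0.
have [S Sg] := eigpow_op dotH sD eb p0.
have Sa x : badjfun S x = S x by exact: (coef_adj dotH sD eb Sg).
have TE : abs_inv_pow dom D s = S \o S.
  by have := abs_inv_powE dotH sD eb Sg; rewrite -splitr.
have tauT : tau (S \o S) = sqw tau S.
  by rewrite /sqw; congr tau; apply/funext => x /=; rewrite Sa.
have := hnt; rewrite /nontrivial_on TE (abs_op_square dotH sD eb Sg) /= tauT.
move=> /andP[Spos fS].
have rS : 0 < rsqw tau S by rewrite -lte_fin -(rsqwE dotH tauW fS).
rewrite -/(rsqw tau S).
pose rep a : bop dot := Bop (actB a) (actB (star a)) (actA a).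
have wv a : weight_value dot tau (act a \o (S \o S)) (ip tau (bcomp (rep a) S) S).
  exact: (weight_value_right dotH tauW Sa fS).
have trE a := trace_ofE tauW (wv a).
have fl Z : finw tau (bcomp Z S) by exact: (finw_compl dotH tauW).
have r0 : (rsqw tau S)%:C != 0 :> R[i].
  by rewrite -[0]/(0%:C) (inj_eq (@complexI R)) gt_eqF.
split=> [a|]; first by exists (ip tau (bcomp (rep a) S) S); exact: wv.
split.
- move=> c a b; rewrite !trE mulrA -mulrDl; congr (_ / _).
  have := weight_value_lin tauW c (wv a) (wv b); apply: (weight_value_unique tauW).
  have -> // : c *: (act a \o (S \o S)) + (act b \o (S \o S)) =
    act (c *: a + b) \o (S \o S).
  by apply/funext => x; rewrite actL.
- move=> a; rewrite trE divr_ge0 ?ler0c ?(ltW rS) //.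
  (* By the trace property, tau(a^* a S^2) is the value at S a^* a S = (a S)^* (a S). *)
  suff -> : ip tau (bcomp (rep (mul (star a) a)) S) S = (rsqw tau (bcomp (rep a) S))%:C.
    by rewrite ler0c rsqw_ge0.
  have h1 := weight_value_ip dotH tauW (fl (rep (mul (star a) a))) fS.
  have h2 := weight_value_square dotH tauW (fl (rep a)).
  apply: (weight_value_unique tauW h1).
  have -> // : badjfun S \o bcomp (rep (mul (star a) a)) S =
    badjfun (bcomp (rep a) S) \o bcomp (rep a) S.
  by apply/funext => x /=; rewrite actM.
- move=> a b; rewrite !trE; congr (_ / _).
  have ipE u v : ip tau (bcomp (rep (mul u v)) S) S =
      ip tau (bcomp (bcomp (rep u) (rep v)) S) S.
    have h := weight_value_right dotH tauW Sa fS (a := act (mul u v))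
      (X := bcomp (rep u) (rep v)).
    by apply: (weight_value_unique tauW (wv (mul u v))); apply: h => x; rewrite actM.
  rewrite !ipE; apply: (ip_commute dotH tauW Sa fS).
  (* The adjoint of [rep b] is the action of [star b], so the commutator hypothesis is used for
     both, with a common nonnegative constant. *)
  have [bdom [M1 bM1]] := dC b; have [adom [M2 aM2]] := dC (star b).
  pose M := Num.max 0 (Num.max M1 M2).
  apply: (commutator_null dotH tauW sD eb tau0 p0 Sg fS (b := rep b) (M := M)) => //.
  + by rewrite /M le_max lexx.
  + move=> x dx; apply: (@le_trans _ _ (M1 * nrm x)).
      by rewrite -lecR realcM -!nrmE; exact: bM1.
    by rewrite ler_wpM2r ?nrm_ge0 // /M !le_max lexx orbT.
  + move=> x dx; apply: (@le_trans _ _ (M2 * nrm x)).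
      by rewrite -lecR realcM -!nrmE; exact: aM2.
    by rewrite ler_wpM2r ?nrm_ge0 // /M !le_max lexx !orbT.
- move=> a M aM.
  have aM' x : nrm (act a x) <= M * nrm x by rewrite -lecR realcM -!nrmE; exact: aM.
  (* A negative bound would force every vector of H to be 0, and then N(S) = 0. *)
  have M0 : 0 <= M.
    rewrite leNgt; apply/negP => Mneg.
    have x0 (x : H) : nrm x = 0.
      apply/eqP; rewrite eq_le nrm_ge0 andbT.
      by have := aM' x; have := nrm_ge0 (act a x); have := nrm_ge0 x; nra.
    have := rsqw_le dotH tauW (lexx 0) fS (Z := S); rewrite mul0r => h.
    have /h : forall x, nrm (S x) ^+ 2 <= 0 * nrm (S x) ^+ 2.
      by move=> x; rewrite x0 expr0n mulr0.
    by rewrite leNgt rS.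
  rewrite trE normrM normfV (abscE (ip _ _ _)) (abscE (rsqw _ _)%:C) absc_real.
  rewrite (gtr0_norm rS) -fmorphV -realcM lecR ler_pdivrMr //.
  rewrite -ler_sqr ?nnegrE ?absc_ge0 ?mulr_ge0 ?(ltW rS) //.
  (* Cauchy-Schwarz for [ip]: |tau(a S^2)|^2 <= N(S) N(a S) <= M^2 N(S)^2, and N(S) is the
     normalizing constant. *)
  apply: le_trans (ip_cauchy_schwarz dotH tauW fS (fl (rep a))) _.
  have := rsqw_compl dotH tauW fS (conj M0 aM' : bnd (rep a) M); nra.
- move=> u uid; have h := weight_value_square dotH tauW fS.
  rewrite trE (_ : ip _ _ _ = (rsqw tau S)%:C) ?divff //.
  apply: (weight_value_unique tauW (wv u)).
  have -> // : act u \o (S \o S) = badjfun S \o S.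
  by apply/funext => x /=; rewrite uid Sa.
Qed.
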